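(* Let $p,q\ge1$, $n=p+q$, let $Q$ be the affine quiver of type $\widetilde{\mathbb A}_{p,q}$ with the orientation given in the context, and let $X(Q)\subset\mathbb C^n$ be its frieze variety. Each irreducible component $Y$ of $X(Q)$ is isomorphic to either $\mathbb C$ or a plane conic. Moreover, in the plane conic case (i.e. when $Y$ is not isomorphic to $\mathbb C$), after a suitable relabelling of the coordinates $x_1,\dots,x_n$ there are $a_i,b_i\in\mathbb C^*$ ($1\le i\le n$) with $\alpha:=a_1b_n-a_nb_1\ne0$ such that $Y$ is the Zariski closure of $\{(\tfrac{a_1t^2+b_1}{t},\dots,\tfrac{a_nt^2+b_n}{t}):t\in\mathbb C^*\}$, and the vanishing ideal $\mathrm I(Y)\subset\mathbb C[x_1,\dots,x_n]$ has the Gröbner basis $\{L_2,\dots,L_{n-1},H\}$ with respect to the lexicographic order $x_2>\dots>x_{n-1}>x_n>x_1$, where $$L_k=x_k+\frac{a_nb_k-b_na_k}{\alpha}x_1-\frac{a_1b_k-b_1a_k}{\alpha}x_n\quad(2\le k\le n-1),$$ $$H=a_nb_nx_1^2-(a_1b_n+a_nb_1)x_1x_n+a_1b_1x_n^2+\alpha^2 .$$ In particular, every irreducible component of $X(Q)$ is smooth.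
   Context: The quiver of type $\widetilde{\mathbb A}_{p,q}$ has vertices $1,\dots,p+q$, a directed path $p+q\to q\to q-1\to\dots\to2\to1$ with $q$ arrows and a directed path $p+q\to p+q-1\to\dots\to q+1\to1$ with $p$ arrows (if $q=1$, resp. $p=1$, the corresponding path is a single arrow $p+q\to1$). Frieze variety: define positive rational numbers by $a_{i,0}=1$ and $a_{i,t+1}a_{i,t}=\prod_{j\to i}a_{j,t}\cdot\prod_{i\to k}a_{k,t+1}+1$ for $t\ge0$ and $1\le i\le n$ (products over arrows of $Q$; equivalently $(a_{1,t},\dots,a_{n,t})=\mu_c^t(\mathbf x)|_{\mathbf x=(1,\dots,1)}$ where $\mu_c=\mu_n\cdots\mu_1$ is the Coxeter mutation). Then $X(Q)$ is the Zariski closure in $\mathbb C^n$ of $\{(a_{1,t},\dots,a_{n,t}):t\ge0\}$. A plane conic means a curve in $\mathbb C^2$ defined by a polynomial of degree $2$. *)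

(* Defs.v *)
From HB Require Import structures.
From mathcomp Require Import all_boot all_order all_algebra perm.
From mathcomp Require Import classical_sets reals complex mpoly.

Set Implicit Arguments.
Unset Strict Implicit.
Unset Printing Implicit Defensive.

Import Order.TTheory GRing.Theory Num.Theory.

Local Open Scope classical_set_scope.
Local Open Scope ring_scope.

(* [Q j i] is the number of arrows j -> i. *)
Definition quiver (n : nat) := 'I_n -> 'I_n -> nat.

Definition path_arrows (s : seq nat) : seq (nat * nat) := zip s (behead s).

(* Arrows p+q -> q -> q-1 -> ... -> 1 and p+q -> p+q-1 -> ... -> q+1 -> 1 on the
   labels 1, ..., p+q; the ordinal i carries the label i.+1. *)
Definition Atilde_arrows (p q : nat) : seq (nat * nat) :=
  path_arrows ((p + q)%N :: rev (iota 1 q)) ++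
  path_arrows (rcons (rev (iota q.+1 p)) 1%N).

Definition Atilde (p q : nat) : quiver (p + q) :=
  fun j i => count_mem (j.+1, i.+1) (Atilde_arrows p q).
Arguments Atilde p q : clear implicits.

Section Frieze.
Variables (n : nat) (Q : quiver n).

(* Cluster mutation at a sink or a source; each vertex is a sink of the quiver
   obtained by mutating at all smaller vertices. *)
Definition mutate (x : 'I_n -> rat) (i : 'I_n) : 'I_n -> rat :=
  fun k => if k == i
           then (\prod_j x j ^+ Q j i * \prod_j x j ^+ Q i j + 1) / x i
           else x k.

Definition coxeter_mutation (x : 'I_n -> rat) : 'I_n -> rat :=
  foldl mutate x (enum 'I_n).

(* [frieze t i] is a_{i,t}.  The mutations satisfy the frieze recurrence when
   every arrow goes from a larger to a smaller vertex ([frieze_rec]). *)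
Definition frieze (t : nat) : 'I_n -> rat :=
  iter t coxeter_mutation (fun=> 1).

Lemma foldl_mutate_notin (x : 'I_n -> rat) (s : seq 'I_n) (k : 'I_n) :
  k \notin s -> foldl mutate x s k = x k.
Proof.
elim: s x => [|i s IHs] x //=; rewrite in_cons negb_or => /andP[ki ks].
by rewrite IHs // /mutate (negbTE ki).
Qed.

Lemma mutate_gt0 (x : 'I_n -> rat) (i : 'I_n) :
  (forall k, 0 < x k) -> forall k, 0 < mutate x i k.
Proof.
move=> x0 k; rewrite /mutate; case: eqP => // _.
rewrite divr_gt0 // ltr_wpDl ?ltr01 // mulr_ge0 // prodr_ge0 // => j _;
  by rewrite exprn_ge0 // ltW.
Qed.

Lemma foldl_mutate_gt0 (x : 'I_n -> rat) (s : seq 'I_n) :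
  (forall k, 0 < x k) -> forall k, 0 < foldl mutate x s k.
Proof. by elim: s x => [|i s IHs] x x0 //=; apply/IHs/mutate_gt0. Qed.

Lemma frieze0 (i : 'I_n) : frieze 0 i = 1.
Proof. by []. Qed.

Lemma frieze_gt0 (t : nat) (i : 'I_n) : 0 < frieze t i.
Proof.
elim: t i => [|t IHt] i; first exact: ltr01.
exact: foldl_mutate_gt0.
Qed.

Lemma frieze_rec (t : nat) (i : 'I_n) :
  (forall j k, (0 < Q j k)%N -> (k < j)%N) ->
  frieze t.+1 i * frieze t i =
    \prod_j frieze t j ^+ Q j i * \prod_k frieze t.+1 k ^+ Q i k + 1.
Proof.
move=> acyc; have x0 := frieze_gt0 t.
rewrite [frieze t.+1]/(coxeter_mutation (frieze t)).
move: (frieze t) x0 => x x0; rewrite /coxeter_mutation.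
have /path.splitPr def_e : i \in enum 'I_n by rewrite mem_enum.
have: sorted ltn (map val (enum 'I_n)) by rewrite val_enum_ord iota_ltn_sorted.
have: forall k : 'I_n, k \in enum 'I_n by move=> k; rewrite mem_enum.
case: def_e => s1 s2 all_in.
rewrite sorted_pairwise; last exact: ltn_trans.
rewrite map_cat pairwise_cat /= allrel_consr.
case/and3P => /andP[/allP lt1 _] _ /andP[/allP lt2 _].
have s1P k : k \in s1 -> (k < i)%N by move=> ks; apply/lt1/map_f.
have s2P k : k \in s2 -> (i < k)%N by move=> ks; apply/lt2/map_f.
have is1 : i \notin s1 by apply/negP => /s1P; rewrite ltnn.
have is2 : i \notin s2 by apply/negP => /s2P; rewrite ltnn.
rewrite foldl_cat /=; set y := foldl mutate x s1.
rewrite foldl_mutate_notin // {1}/mutate eqxx.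
rewrite {3}/y foldl_mutate_notin // divfK ?lt0r_neq0 //.
congr (_ * _ + 1); apply: eq_bigr => k _.
- case: (posnP (Q k i)) => [->|/acyc ik]; first by rewrite !expr0.
  rewrite /y foldl_mutate_notin //; apply/negP => /s1P.
  by rewrite ltnNge (ltnW ik).
- case: (posnP (Q i k)) => [->|/acyc ki]; first by rewrite !expr0.
  rewrite foldl_mutate_notin; last first.
    by apply/negP => /s2P; rewrite ltnNge (ltnW ki).
  by rewrite /mutate; case: eqP ki => // ->; rewrite ltnn.
Qed.

End Frieze.

Lemma path_arrows_sorted (s : seq nat) (j i : nat) :
  sorted (fun x y => y < x)%N s -> (j, i) \in path_arrows s -> (i < j)%N.
Proof.
case: s => [//|x s]; rewrite /path_arrows /=.
elim: s x => [//|y s IHs] x /= /andP[yx /IHs ys].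
by rewrite in_cons => /orP[/eqP[-> ->]|/ys].
Qed.

Lemma Atilde_acyclic (p q : nat) (j i : 'I_(p + q)) :
  (0 < p)%N -> (0 < q)%N -> (0 < Atilde p q j i)%N -> (i < j)%N.
Proof.
move=> p0 q0; rewrite /Atilde -has_count has_pred1 mem_cat -ltnS.
have sorted_rev m r : sorted (fun x y => y < x)%N (rev (iota m r)).
  by rewrite rev_sorted iota_ltn_sorted.
case/orP; apply: path_arrows_sorted.
  rewrite /= path_min_sorted ?sorted_rev //.
  by apply/allP => x; rewrite mem_rev mem_iota => /andP[_ xq];
    exact: leq_trans xq (leq_add p0 (leqnn _)).
rewrite -cats1 -[_ ++ _]revK rev_cat revK rev_sorted /=.
rewrite path_min_sorted ?iota_ltn_sorted //.
by apply/allP => x; rewrite mem_iota => /andP[qx _]; exact: leq_trans qx.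
Qed.

Lemma Atilde_frieze_rec (p q t : nat) (i : 'I_(p + q)) :
  (0 < p)%N -> (0 < q)%N ->
  frieze (Atilde p q) t.+1 i * frieze (Atilde p q) t i =
    \prod_j frieze (Atilde p q) t j ^+ Atilde p q j i *
    \prod_k frieze (Atilde p q) t.+1 k ^+ Atilde p q i k + 1.
Proof. by move=> p0 q0; apply: frieze_rec => j k; apply: Atilde_acyclic. Qed.

Section Zariski.
Variables (K : closedFieldType) (n : nat).
Implicit Types (S X Y Z : set ('I_n -> K)) (I : set {mpoly K[n]}).

Definition zero_locus I : set ('I_n -> K) := [set x | forall f, I f -> f.@[x] = 0].

Definition vanishing_ideal S : set {mpoly K[n]} :=
  [set f | forall x, S x -> f.@[x] = 0].

Definition zariski_closed Z := exists I, Z = zero_locus I.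

Definition zariski_closure S := zero_locus (vanishing_ideal S).

Definition irreducible Y :=
  Y !=set0 /\
  forall A B, zariski_closed A -> zariski_closed B -> Y `<=` A `|` B ->
    Y `<=` A \/ Y `<=` B.

Definition irreducible_component X Y :=
  [/\ zariski_closed Y, irreducible Y, Y `<=` X &
      forall Z, zariski_closed Z -> irreducible Z -> Z `<=` X ->
        Y `<=` Z -> Z = Y].

Definition irreducible_chain Y (d : nat) :=
  exists Z : nat -> set ('I_n -> K),
    (forall i, (i <= d)%N ->
       [/\ zariski_closed (Z i), irreducible (Z i) & Z i `<=` Y]) /\
    (forall i, (i < d)%N -> Z i `<` Z i.+1).

Definition has_dim Y (d : nat) :=
  irreducible_chain Y d /\ ~ irreducible_chain Y d.+1.

Definition tangent_space Y (x : 'I_n -> K) : set 'rV[K]_n :=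
  [set v | forall f, vanishing_ideal Y f -> \sum_i (mderiv i f).@[x] * v 0 i = 0].

(* Smoothness of an irreducible closed [Y], so that all its local dimensions
   equal its dimension. *)
Definition smooth Y :=
  exists2 d, has_dim Y d &
    forall x, Y x -> exists2 V : {vspace 'rV[K]_n},
      tangent_space Y x = [set v | v \in V] & \dim V = d.

End Zariski.

Definition polymap (K : closedFieldType) (m n : nat)
    (f : 'I_n -> {mpoly K[m]}) (x : 'I_m -> K) : 'I_n -> K :=
  fun i => (f i).@[x].

Definition isomorphic (K : closedFieldType) (m n : nat)
    (Y : set ('I_m -> K)) (Z : set ('I_n -> K)) :=
  exists (f : 'I_n -> {mpoly K[m]}) (g : 'I_m -> {mpoly K[n]}),
    [/\ forall x, Y x -> Z (polymap f x),
        forall z, Z z -> Y (polymap g z),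
        forall x, Y x -> polymap g (polymap f x) = x &
        forall z, Z z -> polymap f (polymap g z) = z].

Definition affine_line (K : closedFieldType) : set ('I_1 -> K) := setT.
Arguments affine_line K : clear implicits.

(* [msize] is the total degree plus one. *)
Definition plane_conic (K : closedFieldType) (Z : set ('I_2 -> K)) :=
  exists2 F : {mpoly K[2]}, msize F = 3%N & Z = zero_locus [set F].

Section Groebner.
Variables (K : closedFieldType) (n : nat) (vars : seq 'I_n).
Implicit Types (S I : set {mpoly K[n]}) (G : seq {mpoly K[n]}).

(* Lexicographic order; the variables in [vars] are listed from the largest to
   the smallest. *)
Definition lex_le (m1 m2 : 'X_{1..n}) : bool :=
  ([seq m1 i | i <- vars] <= [seq m2 i | i <- vars] :> seqlexi nat)%O.

Definition is_leading_monomial (f : {mpoly K[n]}) (m : 'X_{1..n}) :=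
  m \in msupp f /\ forall m', m' \in msupp f -> lex_le m' m.

Definition leading_terms S : set {mpoly K[n]} :=
  [set u | exists f m,
    [/\ S f, is_leading_monomial f m & u = f@_m *: 'X_[m]]].

Definition ideal_generated S : set {mpoly K[n]} :=
  [set f | exists (r : nat) (c g : 'I_r -> {mpoly K[n]}),
    (forall i, S (g i)) /\ f = \sum_i c i * g i].

Definition groebner_basis I G :=
  {in G, forall g, I g} /\
  ideal_generated (leading_terms [set g | g \in G]) =
  ideal_generated (leading_terms I).

End Groebner.

Definition frieze_variety (C : numClosedFieldType) (n : nat) (Q : quiver n) :
    set ('I_n -> C) :=
  zariski_closure [set x | exists t, x = fun i => ratr (frieze Q t i)].
Arguments frieze_variety C {n} Q.

Section Conic.
Variables (C : numClosedFieldType) (n : nat) (n_gt0 : (0 < n)%N).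

Definition first_vertex : 'I_n := Ordinal n_gt0.
Definition last_vertex : 'I_n := rev_ord first_vertex.

Local Notation v1 := first_vertex.
Local Notation vn := last_vertex.

(* The variables in the order x_2 > ... > x_n > x_1. *)
Definition lex_vars : seq 'I_n := rot 1 (enum 'I_n).

Variables a b : 'I_n -> C.

Definition hyperbola : set ('I_n -> C) :=
  [set x | exists2 t : C, t != 0 & x = fun i => (a i * t ^+ 2 + b i) / t].

Definition alpha : C := a v1 * b vn - a vn * b v1.

Definition Lpoly (k : 'I_n) : {mpoly C[n]} :=
  'X_k + ((a vn * b k - b vn * a k) / alpha) *: 'X_v1
       - ((a v1 * b k - b v1 * a k) / alpha) *: 'X_vn.

Definition Hpoly : {mpoly C[n]} :=
  (a vn * b vn) *: 'X_v1 ^+ 2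
  - (a v1 * b vn + a vn * b v1) *: ('X_v1 * 'X_vn)
  + (a v1 * b v1) *: 'X_vn ^+ 2 + (alpha ^+ 2)%:MP.

Definition conic_basis : seq {mpoly C[n]} :=
  rcons [seq Lpoly k | k : 'I_n <- enum 'I_n & (0 < k < n.-1)%N] Hpoly.

End Conic.

(* Main.v *)
Require Import Defs.
From mathcomp Require Import all_boot all_order all_algebra perm.
From mathcomp Require Import boolp classical_sets reals complex mpoly.
From mathcomp Require Import ring zify.

(* Unfolding the annulus turns the frieze into an SL2-tiling of the quadrant
   with ones on its staircase boundary.  Let d, e be the roots of
   X^2 - pq X - pq; then (1 + d)(1 + e) = 1, and the tiling is explicitly
     M(a, b) = (f_d(a) g_d(b) / d - f_e(a) g_e(b) / e) / (d - e),
   where f_d(a + q) = (1 + d) f_d(a), g_d(b + p) = (1 + d) g_d(b), and f_d, g_d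
   are affine between multiples of q, resp. p.  Both vertex coordinates advance
   by 1 at each step, so along each residue class of t modulo pq every a_{i,t}
   is u_i l^m + v_i l^(-m) with l = (1 + d)^(p + q) > 1 and u_i, v_i nonzero.
   Hence X(Q) is a finite union of curves {u_i t + v_i / t}.  Such a curve is a
   line when u and v are proportional; otherwise, for a nonzero minor
   D = u_j v_k - u_k v_j, the linear forms U = u_k x_j - u_j x_k and
   W = v_k x_j - v_j x_k satisfy U W = - D^2 and D x_i = u_i W - v_i U. *)

Set Implicit Arguments.
Unset Strict Implicit.
Unset Printing Implicit Defensive.

Import Order.TTheory GRing.Theory Num.Theory.
Local Open Scope classical_set_scope.
Local Open Scope ring_scope.

(** * The SL2-tiling *)

Section Wave.
Variable F : fieldType.
Implicit Types d e : F.

(* At [k * m + r], [r < m], this is [(1 + d) ^+ k] times the linear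
   interpolation [m + d * r] between [m] and [m * (1 + d)]. *)
Definition wave d (m a : nat) : F :=
  (1 + d) ^+ (a %/ m) * (m%:R + d * (a %% m)%:R).

Lemma waveDM d m a k :
  (0 < m)%N -> wave d m (a + m * k) = (1 + d) ^+ k * wave d m a.
Proof.
by move=> m0; rewrite /wave addnC mulnC divnMDl // modnMDl exprD mulrA.
Qed.

(** The first affine piece ends at [m * (1 + d)], where the next one starts, so the formula still
    holds at [a = m]. *)
Lemma wave_le d m a : (0 < m)%N -> (a <= m)%N -> wave d m a = m%:R + d * a%:R.
Proof.
move=> m0; rewrite leq_eqVlt => /predU1P[->|am].
  by rewrite /wave divnn m0 modnn; ring.
by rewrite /wave divn_small // modn_small // mul1r.
Qed.

(** On one affine piece this is the constant Wronskian of [m + d a] and [m + e a]; the next piece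
    scales it by [(1 + d) (1 + e) = 1]. *)
Lemma wave_wronskian d e m a : (0 < m)%N -> (1 + d) * (1 + e) = 1 ->
  wave d m a * wave e m a.+1 - wave d m a.+1 * wave e m a = m%:R * (e - d).
Proof.
move=> m0 de1.
suff key r k : (r < m)%N ->
    wave d m (r + m * k) * wave e m (r.+1 + m * k) -
    wave d m (r.+1 + m * k) * wave e m (r + m * k) = m%:R * (e - d).
  have := key _ (a %/ m)%N (ltn_pmod a m0).
  by rewrite addSn addnC mulnC -divn_eq.
move=> rm; rewrite (waveDM d r) // (waveDM e r) // (waveDM d r.+1) //.
rewrite (waveDM e r.+1) // !wave_le ?(ltnW rm) // -natr1.
have : (1 + d) ^+ k * (1 + e) ^+ k = 1 by rewrite -exprMn de1 expr1n.
move: (_ ^+ k) (_ ^+ k) => x y xy; rewrite -[RHS]mul1r -[X in _ = X * _]xy; ring.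
Qed.

End Wave.

Definition tiling_coef (C : fieldType) (d e : C) : C := (d * (d - e))^-1.

Definition tiling (C : fieldType) (p q : nat) (d e : C) (a b : nat) : C :=
  tiling_coef d e * wave d q a * wave d p b +
  tiling_coef e d * wave e q a * wave e p b.

Section Tiling.
Variables (C : numFieldType) (p q : nat).
Hypotheses (p_gt0 : (0 < p)%N) (q_gt0 : (0 < q)%N).
Variables d e : C.
Hypotheses (deD : d + e = (p * q)%:R) (deM : d * e = - (p * q)%:R).

(** A zero would force [d r = - m] with [r < m]. Then [d^2 = pq (d + 1)] gives
    [m^2 + pq r m = pq r^2], impossible since [pq r^2 <= pq r m]. This covers the negative root as
    well. *)
Lemma wave_neq0 m m' a : (0 < m)%N -> (0 < m')%N -> (m * m' = p * q)%N ->
  wave d m a != 0.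
Proof.
move=> m0 m'0 mm'; have am := ltn_pmod a m0.
have d0 : d != 0.
  apply/eqP => d0; move: deM; rewrite d0 mul0r => /esym/eqP.
  by rewrite oppr_eq0 pnatr_eq0 muln_eq0; lia.
have dd : d ^+ 2 = (p * q)%:R * d + (p * q)%:R.
  by rewrite -{2}[(p * q)%:R]opprK -deM -deD; ring.
have d1 : 1 + d != 0.
  apply/eqP => d1; have : d ^+ 2 == 0 by rewrite dd -[d](addKr 1) d1; apply/eqP; ring.
  by rewrite expf_eq0 (negPf d0).
rewrite mulf_neq0 ?expf_neq0 //; move: am; set r := (a %% m)%N => am.
apply/negP => /eqP dr.
have /eqP : (m * (m + p * q * r))%:R = (m * m' * r ^ 2)%:R :> C.
  have dr' : d * r%:R = - m%:R by apply/eqP; rewrite -addr_eq0 addrC dr.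
  have : (d * r%:R) ^+ 2 = (- m%:R) ^+ 2 by rewrite dr'.
  rewrite exprMn dd mm' !natrM natrD => h.
  have -> : m%:R * (m%:R + (p * q * r)%:R) = (- m%:R) ^+ 2 - (p * q)%:R * r%:R * (- m%:R) :> C.
    by rewrite !natrM; ring.
  by rewrite -h -dr' !natrM; ring.
rewrite eqr_nat -mm' => /eqP.
have : (m * (m * m' * r) >= m * m' * r ^ 2)%N.
  by rewrite !mulnA [(m * m * m')%N]mulnAC leq_mul // leq_mul // ltnW.
have : (0 < m * m)%N by rewrite muln_gt0 m0.
by rewrite mulnDr; lia.
Qed.

Hypothesis deN : d != e.

Lemma de_neq0 : [/\ d != 0, e != 0, d - e != 0 & e - d != 0].
Proof.
have : d * e != 0 by rewrite deM oppr_eq0 pnatr_eq0 muln_eq0; lia.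
by rewrite mulf_eq0 negb_or => /andP[-> ->]; rewrite !subr_eq0 deN eq_sym.
Qed.

Lemma deD1 : (1 + d) * (1 + e) = 1.
Proof.
have -> : (1 + d) * (1 + e) = 1 + (d + e) + d * e by ring.
by rewrite deD deM; ring.
Qed.

(** The coefficients cancel the terms linear in [a] and [b], give [a b] the coefficient 1, and leave
    the constant [- pq / (d e) = 1]. *)
Lemma tiling_le a b : (a <= q)%N -> (b <= p)%N ->
  tiling p q d e a b = 1 + a%:R * b%:R.
Proof.
move=> aq bp; have [d0 e0 de0 ed0] := de_neq0.
rewrite /tiling /tiling_coef !wave_le //.
have pq : p%:R * q%:R = - (d * e) by rewrite deM opprK natrM.
apply/eqP; rewrite -subr_eq0; apply/eqP.
transitivity ((p%:R * q%:R + d * e) * - (d * e)^-1).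
  by field; rewrite d0 e0 de0 ed0.
by rewrite pq addNr mul0r.
Qed.

(** The tiling is a sum of two rank-one arrays, so by Cauchy-Binet a 2 x 2 minor is the product of
    the two coefficients and the two Wronskians; [d e = - pq] normalizes it to 1. *)
Lemma tiling_sl2 a b :
  tiling p q d e a b * tiling p q d e a.+1 b.+1 =
  tiling p q d e a.+1 b * tiling p q d e a b.+1 + 1.
Proof.
have [d0 e0 de0 ed0] := de_neq0.
have := wave_wronskian a q_gt0 deD1; have := wave_wronskian b p_gt0 deD1.
rewrite /tiling /tiling_coef.
move: (wave d q a) (wave e q a) (wave d q a.+1) (wave e q a.+1).
move: (wave d p b) (wave e p b) (wave d p b.+1) (wave e p b.+1).
move=> x y x' y' z w z' w' h1 h2.
apply/eqP; rewrite -subr_eq0 opprD addrA subr_eq0; apply/eqP.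
transitivity ((x * y' - x' * y) * (z * w' - z' * w) / (d * e * (d - e) * (e - d))).
  by field; rewrite d0 e0 de0 ed0.
rewrite h1 h2 deM natrM; field.
by rewrite de0 ed0 !pnatr_eq0 -!lt0n p_gt0 q_gt0.
Qed.

(** Either shift multiplies the [d]-term by [1 + d] and the [e]-term by [1 + e]. *)
Lemma tilingD a b : tiling p q d e (a + q) b = tiling p q d e a (b + p).
Proof.
have sh f m c : (0 < m)%N -> wave f m (c + m) = (1 + f) * wave f m c :> C.
  by move=> m0; have := waveDM f c 1 m0; rewrite muln1 expr1.
by rewrite /tiling !sh //; ring.
Qed.

(** The shift spans [p k] periods of one wave and [q k] of the other, hence the exponent
    [(p + q) k]. *)
Lemma tilingDM a b k : tiling p q d e (a + p * q * k) (b + p * q * k) =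
  tiling_coef d e * wave d q a * wave d p b * (1 + d) ^+ ((p + q) * k) +
  tiling_coef e d * wave e q a * wave e p b * (1 + e) ^+ ((p + q) * k).
Proof.
have -> : (a + p * q * k = a + q * (p * k))%N by lia.
have -> : (b + p * q * k = b + p * (q * k))%N by lia.
by rewrite /tiling !waveDM // mulnDl !exprD; ring.
Qed.

End Tiling.

(** * Frieze values *)

Section FriezeValue.
Variables (p q : nat).
Hypotheses (p_gt0 : (0 < p)%N) (q_gt0 : (0 < q)%N).

(* The label of the vertex at distance [j] from vertex 1 along the path of
   length [q], resp. [p]; both paths end at [p + q]. *)
Definition upper_label (j : nat) := if j == q then (p + q)%N else j.+1.
Definition lower_label (j : nat) := if j == 0 then 1%N else (q + j)%N.

Lemma rev_iota0S k : rev (iota 0 k.+1) = k :: rev (iota 0 k).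
Proof. by rewrite -addn1 iotaD rev_cat. Qed.

Lemma path_arrows_map (L : nat -> nat) (m : nat) :
  path_arrows [seq L j | j <- rev (iota 0 m.+1)] =
  [seq (L j.+1, L j) | j <- rev (iota 0 m)].
Proof.
rewrite /path_arrows; elim: m => [//|m IHm].
rewrite (rev_iota0S m) /= in IHm; by rewrite (rev_iota0S m.+1) (rev_iota0S m) /= IHm.
Qed.

Lemma Atilde_arrowsE : Atilde_arrows p q =
  [seq (upper_label j.+1, upper_label j) | j <- rev (iota 0 q)] ++
  [seq (lower_label j.+1, lower_label j) | j <- rev (iota 0 p)].
Proof.
rewrite -!path_arrows_map /Atilde_arrows; congr (path_arrows _ ++ path_arrows _).
  rewrite rev_iota0S /= /upper_label eqxx; congr (_ :: _).
  rewrite !map_rev; congr rev; rewrite (iotaDl 1 0); apply/eq_in_map => j.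
  by rewrite mem_iota add1n /= => jq; rewrite ltn_eqF.
rewrite /= rev_cons map_rcons; congr rcons; rewrite map_rev; congr rev.
rewrite -[q.+1]addn1 iotaDl; apply/eq_in_map => -[|j];
  by rewrite mem_iota.
Qed.

(** Exponents count arrows with multiplicity, so the product regroups over arrows; this also handles
    the double arrow of [p = q = 1]. *)
Lemma prod_arrows_in (R : comNzRingType) (X : nat -> R) (s : seq (nat * nat))
    (l : nat) :
  (forall e, e \in s -> (0 < e.1 <= p + q)%N) ->
  \prod_(j < p + q) X j.+1 ^+ count_mem (j.+1, l) s =
  \prod_(e <- s | e.2 == l) X e.1.
Proof.
elim: s => [|e s IHs] es; first by rewrite big_nil big1 // => j _; rewrite expr0.
rewrite big_cons /= -IHs; last by move=> f fs; apply: es; rewrite in_cons fs orbT.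
under eq_bigr do rewrite exprD; rewrite big_split /=.
have /es/andP[e1 e1n] := mem_head e s.
have e1p : (e.1.-1 < p + q)%N by rewrite prednK.
case: e e1 e1p {es e1n} => u v /= u0 up.
case: eqP => [->|/eqP vl]; last first.
  by rewrite big1 ?mul1r // => j _; rewrite xpair_eqE (negPf vl) andbF expr0.
rewrite (bigD1 (Ordinal up)) //= prednK // eqxx expr1 big1 ?mulr1 // => j ju.
rewrite xpair_eqE eqxx andbT; case: eqP => [uj|//].
by case/eqP: ju; apply: val_inj; rewrite /= uj.
Qed.

Lemma prod_arrows_out (R : comNzRingType) (X : nat -> R) (s : seq (nat * nat))
    (l : nat) :
  (forall e, e \in s -> (0 < e.2 <= p + q)%N) ->
  \prod_(j < p + q) X j.+1 ^+ count_mem (l, j.+1) s =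
  \prod_(e <- s | e.1 == l) X e.2.
Proof.
move=> es; pose swap (e : nat * nat) := (e.2, e.1).
have := @prod_arrows_in R X (map swap s) l; rewrite big_map => <-.
  apply: eq_bigr => j _; rewrite count_map; congr (_ ^+ _); apply: eq_count => e.
  by rewrite /swap /= !xpair_eqE andbC.
by move=> _ /mapP[e /es ? ->].
Qed.

(** At most one arrow of a path starts, or ends, at a given vertex; an index [k >= m] encodes that
    there is none. *)
Lemma prod_iota_pred1 (R : comNzRingType) (m k : nat) (P : pred nat) (G : nat -> R) :
  (forall j, (j < m)%N -> P j = (j == k)) ->
  \prod_(j <- rev (iota 0 m) | P j) G j = if (k < m)%N then G k else 1.
Proof.
move=> Pk; have -> : \prod_(j <- rev (iota 0 m) | P j) G j = \prod_(j < m | P j) G j.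
  by rewrite -(big_mkord P) /index_iota subn0; apply: perm_big; rewrite perm_rev.
case: ltnP => km.
  by rewrite (big_pred1 (Ordinal km)) // => j; rewrite Pk //.
by rewrite big_pred0 // => j; rewrite Pk // ltn_eqF // (leq_trans _ km).
Qed.

Lemma prod_Atilde_in (R : comNzRingType) (X : nat -> R) (i : 'I_(p + q)) (k k' : nat) :
  (forall j, (j < q)%N -> (upper_label j == i.+1) = (j == k)) ->
  (forall j, (j < p)%N -> (lower_label j == i.+1) = (j == k')) ->
  \prod_(j < p + q) X j.+1 ^+ Atilde p q j i =
  (if (k < q)%N then X (upper_label k.+1) else 1) *
  (if (k' < p)%N then X (lower_label k'.+1) else 1).
Proof.
move=> hk hk'; rewrite prod_arrows_in Atilde_arrowsE; last first.
  move=> e; rewrite mem_cat => /orP[] /mapP[j]; rewrite mem_rev mem_iota => jq -> /=;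
    rewrite /upper_label /lower_label /=; try case: ifP; lia.
by rewrite big_cat !big_map !(prod_iota_pred1 _ hk, prod_iota_pred1 _ hk').
Qed.

Lemma prod_Atilde_out (R : comNzRingType) (X : nat -> R) (i : 'I_(p + q)) (k k' : nat) :
  (forall j, (j < q)%N -> (upper_label j.+1 == i.+1) = (j == k)) ->
  (forall j, (j < p)%N -> (lower_label j.+1 == i.+1) = (j == k')) ->
  \prod_(j < p + q) X j.+1 ^+ Atilde p q i j =
  (if (k < q)%N then X (upper_label k) else 1) *
  (if (k' < p)%N then X (lower_label k') else 1).
Proof.
move=> hk hk'; rewrite prod_arrows_out Atilde_arrowsE; last first.
  move=> e; rewrite mem_cat => /orP[] /mapP[j]; rewrite mem_rev mem_iota => jq -> /=;
    rewrite /upper_label /lower_label /=; try case: ifP; lia.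
by rewrite big_cat !big_map !(prod_iota_pred1 _ hk, prod_iota_pred1 _ hk').
Qed.

Section Value.
Variables (C : numFieldType) (d e : C).
Hypotheses (deD : d + e = (p * q)%:R) (deM : d * e = - (p * q)%:R) (deN : d != e).

Local Notation M := (tiling p q d e).

(* Vertex 1 sits at [(t, t)] at time [t]; the two paths leave it along the two
   axes and close up by [tilingD]. *)
Definition label_value (t l : nat) : C :=
  if (l <= q)%N then M (l.-1 + t) t else M t (l - q + t).

Lemma label_value_upper t j : (j <= q)%N -> label_value t (upper_label j) = M (j + t) t.
Proof.
rewrite /label_value /upper_label; case: eqP => [-> _|jq jq'].
  (* The label [p + q] exceeds [q], so its value is read on the other axis and carried over by
     [tilingD]. *)
  rewrite ifF; last by lia.
  by rewrite addnK addnC [(q + t)%N]addnC tilingD.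
by rewrite ifT //; lia.
Qed.

Lemma label_value_lower t j : label_value t (lower_label j) = M t (j + t).
Proof.
rewrite /label_value /lower_label; case: eqP => [->|/eqP j0]; first by rewrite q_gt0.
by rewrite ifF ?addKn //; lia.
Qed.

(** Each case is [tiling_sl2] on the square whose diagonal holds the vertex at times [t] and
    [t + 1]; the other two corners are its in-neighbours at [t] and out-neighbours at [t + 1].
    Indices [q] and [p] stand for absent arrows. *)
Lemma label_value_rec t (i : 'I_(p + q)) :
  label_value t.+1 i.+1 * label_value t i.+1 =
    \prod_(j < p + q) label_value t j.+1 ^+ Atilde p q j i *
    \prod_(k < p + q) label_value t.+1 k.+1 ^+ Atilde p q i k + 1.
Proof.
have ipq := ltn_ord i; have sl2 := tiling_sl2 p_gt0 q_gt0 deD deM deN.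
(* Vertex 1, the sink. *)
have [i0|i0] := posnP i.
  rewrite (@prod_Atilde_in _ _ _ 0 0) => [|j jq|j jp]; first last.
  - by rewrite /lower_label /=; try case: ifP; lia.
  - by rewrite /upper_label /=; try case: ifP; lia.
  rewrite (@prod_Atilde_out _ _ _ q p) => [|j jq|j jp]; first last.
  - by rewrite /lower_label /=; try case: ifP; lia.
  - by rewrite /upper_label /=; try case: ifP; lia.
  rewrite p_gt0 q_gt0 !ltnn !mulr1 label_value_lower label_value_upper //.
  have -> : i.+1 = lower_label 0 by rewrite i0.
  by rewrite !label_value_lower mulrC !add1n !add0n sl2.
(* Interior vertices of the path of length [q]. *)
have [iq|iq] := ltnP i q.
  rewrite (@prod_Atilde_in _ _ _ i p) => [|j jq|j jp]; first last.
  - by rewrite /lower_label /=; try case: ifP; lia.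
  - by rewrite /upper_label /=; try case: ifP; lia.
  rewrite (@prod_Atilde_out _ _ _ i.-1 p) => [|j jq|j jp]; first last.
  - by rewrite /lower_label /=; try case: ifP; lia.
  - by rewrite /upper_label /=; try case: ifP; lia.
  rewrite iq (leq_ltn_trans (leq_pred i)) // ltnn !mulr1.
  rewrite !label_value_upper ?(leq_trans (leq_pred i) (ltnW iq)) //.
  have lv s : label_value s i.+1 = M (i + s) s.
    by rewrite -label_value_upper ?(ltnW iq) // /upper_label ltn_eqF.
  rewrite !lv mulrC addnS sl2; congr (M _ _ * M _ _ + _); lia.
(* Interior vertices of the path of length [p]; the source [p + q] remains afterwards. *)
have [il|il] := ltnP i.+1 (p + q).
  rewrite (@prod_Atilde_in _ _ _ q (i.+1 - q)) => [|j jq|j jp]; first last.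
  - by rewrite /lower_label /=; try case: ifP; lia.
  - by rewrite /upper_label /=; try case: ifP; lia.
  rewrite (@prod_Atilde_out _ _ _ q (i - q)) => [|j jq|j jp]; first last.
  - by rewrite /lower_label /=; try case: ifP; lia.
  - by rewrite /upper_label /=; try case: ifP; lia.
  rewrite ltnn !mul1r ifT; last by lia.
  rewrite ifT; last by lia.
  have lv s : label_value s i.+1 = M s (i.+1 - q + s).
    by rewrite -label_value_lower /lower_label; congr label_value; case: eqP; lia.
  rewrite !label_value_lower !lv mulrC addnS sl2 mulrC; congr (M _ _ * M _ _ + _); lia.
rewrite (@prod_Atilde_in _ _ _ q p) => [|j jq|j jp]; first last.
- by rewrite /lower_label /=; try case: ifP; lia.
- by rewrite /upper_label /=; try case: ifP; lia.
rewrite (@prod_Atilde_out _ _ _ q.-1 p.-1) => [|j jq|j jp]; first last.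
- by rewrite /lower_label /=; try case: ifP; lia.
- by rewrite /upper_label /=; try case: ifP; lia.
rewrite !ltnn !mul1r !prednK // !leqnn.
rewrite label_value_lower label_value_upper ?leq_pred //.
have lv s : label_value s i.+1 = M (q + s) s.
  by rewrite -label_value_upper // /upper_label eqxx; congr label_value; lia.
have -> : M t.+1 (p.-1 + t.+1) = M (t.+1 + q) t.
  by rewrite tilingD //; congr tiling; lia.
rewrite !lv mulrC addnS sl2 mulrC; congr (M _ _ * M _ _ + _); lia.
Qed.

(** Both sides satisfy the same recurrence. Induct on the time, then on the vertex: arrows go to
    smaller labels, so the values needed at [t + 1] are already known. *)
Lemma ratr_frieze t (i : 'I_(p + q)) :
  ratr (frieze (Atilde p q) t i) = label_value t i.+1.
Proof.
elim: t i => [|t IHt] i.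
  rewrite frieze0 rmorph1 /label_value; case: ifP => iq.
    by rewrite addn0 tiling_le ?mulr0 ?addr0 //=; lia.
  by rewrite addn0 tiling_le ?mul0r ?addr0 //; have := ltn_ord i; lia.
have [m] := ubnP (i : nat); elim: m i => // m IHm i; rewrite ltnS => im.
have a0 : label_value t i.+1 != 0.
  by rewrite -IHt fmorph_eq0 lt0r_neq0 // frieze_gt0.
apply: (mulIf a0); rewrite label_value_rec -IHt -rmorphM Atilde_frieze_rec //.
rewrite rmorphD rmorph1 rmorphM !rmorph_prod; congr (_ * _ + _).
  by apply: eq_bigr => j _; rewrite rmorphXn /= IHt.
apply: eq_bigr => k _; rewrite rmorphXn /=.
have [->|/(Atilde_acyclic p_gt0 q_gt0) ki] := posnP (Atilde p q i k).
  by rewrite !expr0.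
by rewrite IHm // (leq_trans ki).
Qed.

End Value.

End FriezeValue.

(** * Closed form of the frieze along residue classes of the time *)

Section ClosedForm.
Variables (C : numClosedFieldType) (p q : nat).
Hypotheses (p_gt0 : (0 < p)%N) (q_gt0 : (0 < q)%N).

(** Positivity of [d] is what later makes the powers of [1 + d] distinct. *)
Lemma growth_roots : exists d e : C,
  [/\ 0 < d, d + e = (p * q)%:R, d * e = - (p * q)%:R & d != e].
Proof.
have k0 : 0 < (p * q)%:R :> C by rewrite ltr0n muln_gt0 p_gt0.
move: (_%:R) k0 => k k0; pose s := sqrtC (k ^+ 2 + 4 * k).
have D0 : 0 < k ^+ 2 + 4 * k by rewrite addr_gt0 ?exprn_gt0 ?mulr_gt0.
have s0 : 0 < s by rewrite sqrtC_gt0.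
have sE : s ^+ 2 = k ^+ 2 + 4 * k by rewrite sqrtCK.
exists ((k + s) / 2), ((k - s) / 2); split.
- by rewrite divr_gt0 ?addr_gt0.
- by field.
- have -> : (k + s) / 2 * ((k - s) / 2) = (k ^+ 2 - s ^+ 2) / 4 by field.
  by rewrite sE; field.
- rewrite -subr_eq0; have -> : (k + s) / 2 - (k - s) / 2 = s by field.
  exact: lt0r_neq0.
Qed.

(** As [1 + e] is the inverse of [1 + d], the two terms of [tilingDM] are multiples of [l^m] and
    [l^(-m)] for [l = (1 + d)^(p + q)]. Injectivity provides infinitely many parameters on each
    curve. *)
Lemma frieze_closed_form : exists2 l : C, injective (GRing.exp l) &
  l != 0 /\
  forall r, exists a b : 'I_(p + q) -> C,
    (forall i, a i != 0 /\ b i != 0) /\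
    forall m i, ratr (frieze (Atilde p q) (r + p * q * m) i) =
                (a i * (l ^+ m) ^+ 2 + b i) / l ^+ m.
Proof.
have [d [e [d0 deD deM deN]]] := growth_roots.
have l1 : 1 < 1 + d by rewrite ltrDl.
have l0 : 1 + d != 0 by rewrite lt0r_neq0 // (lt_trans ltr01).
have edM : e * d = - (p * q)%:R by rewrite mulrC.
have edD : e + d = (p * q)%:R by rewrite addrC.
have edN : e != d by rewrite eq_sym.
have [d_n0 e_n0 de_n0 ed_n0] := de_neq0 p_gt0 q_gt0 deM deN.
exists ((1 + d) ^+ (p + q)).
  apply: ieexprIn; first by rewrite exprn_gt0 // (lt_trans ltr01).
  by rewrite gt_eqF // exprn_egt1 // -lt0n addn_gt0 p_gt0.
split=> [|r]; first exact: expf_neq0.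
have eE : 1 + e = (1 + d)^-1 by rewrite -[LHS](mulKf l0) (deD1 deD deM) mulr1.
(* [(x i, y i)] is the position in the tiling of vertex [i] at time [r], as in [label_value]. *)
pose x (i : 'I_(p + q)) := ((if (i < q)%N then i : nat else 0%N) + r)%N.
pose y (i : 'I_(p + q)) := ((if (i < q)%N then 0%N else i.+1 - q) + r)%N.
exists (fun i => tiling_coef d e * wave d q (x i) * wave d p (y i)).
exists (fun i => tiling_coef e d * wave e q (x i) * wave e p (y i)).
split=> [i|m i].
  have qp : (q * p = p * q)%N := mulnC q p.
  split; (apply: mulf_neq0; first apply: mulf_neq0).
  - by rewrite invr_eq0 mulf_neq0.
  - exact: (wave_neq0 p_gt0 q_gt0 deD deM (x i) q_gt0 p_gt0 qp).
  - exact: (wave_neq0 p_gt0 q_gt0 deD deM (y i) p_gt0 q_gt0 erefl).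
  - by rewrite invr_eq0 mulf_neq0.
  - exact: (wave_neq0 p_gt0 q_gt0 edD edM (x i) q_gt0 p_gt0 qp).
  - exact: (wave_neq0 p_gt0 q_gt0 edD edM (y i) p_gt0 q_gt0 erefl).
rewrite (ratr_frieze p_gt0 q_gt0 deD deM deN).
transitivity (tiling p q d e (x i + p * q * m) (y i + p * q * m)).
  by rewrite /label_value /x /y; case: ifP => _; rewrite /= ?add0n ?addnA.
rewrite tilingDM // eE exprVn exprM.
have : ((1 + d) ^+ (p + q)) ^+ m != 0 by rewrite !expf_neq0.
by move: (_ ^+ m) => z z0; field.
Qed.
End ClosedForm.

(** * Zariski topology and rational curves *)

Section ZariskiTopology.
Variables (K : closedFieldType) (n : nat).
Implicit Types (A B Y Z : set ('I_n -> K)) (f : {mpoly K[n]}).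

Lemma zariski_closed0 : zariski_closed (set0 : set ('I_n -> K)).
Proof.
exists [set 1]; apply/seteqP; split=> // x /(_ 1 erefl).
by rewrite meval1 => /eqP; rewrite oner_eq0.
Qed.

Lemma zariski_closedU A B :
  zariski_closed A -> zariski_closed B -> zariski_closed (A `|` B).
Proof.
move=> [I ->] [J ->]; exists [set h | exists f g, [/\ I f, J g & h = f * g]].
apply/seteqP; split=> x.
  by move=> h _ [f [g [If Jg ->]]]; rewrite mevalM;
    case: h => [/(_ f If)|/(_ g Jg)] ->; rewrite ?mul0r ?mulr0.
move=> h; apply: contrapT => /not_orP[/existsNP[f /not_implyP[If /eqP f0]]].
move=> /existsNP[g /not_implyP[Jg /eqP g0]].
have /eqP : (f * g).@[x] = 0 by apply: h; exists f, g.
by rewrite mevalM mulf_eq0 (negPf f0) (negPf g0).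
Qed.

Lemma zariski_closed_cover (A : nat -> set ('I_n -> K)) (N : nat) :
  (forall i, (i < N)%N -> zariski_closed (A i)) ->
  zariski_closed [set x | exists2 i, (i < N)%N & A i x].
Proof.
elim: N => [_|N IHN Acl].
  suff -> : [set x | exists2 i, (i < 0)%N & A i x] = set0 by exact: zariski_closed0.
  by apply/seteqP; split=> // x [].
suff -> : [set x | exists2 i, (i < N.+1)%N & A i x] =
          [set x | exists2 i, (i < N)%N & A i x] `|` A N.
  by apply: zariski_closedU; [apply: IHN => i iN; apply: Acl; apply: ltnW | apply: Acl].
apply/seteqP; split=> x.
  case=> i; rewrite ltnS leq_eqVlt => /predU1P[->|iN] Aix; first by right.
  by left; exists i.
by move=> [[i iN Aix]|ANx]; [exists i => //; apply: ltnW | exists N].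
Qed.

Lemma irreducible_cover Y (A : nat -> set ('I_n -> K)) (N : nat) :
  irreducible Y -> (forall i, (i < N)%N -> zariski_closed (A i)) ->
  Y `<=` [set x | exists2 i, (i < N)%N & A i x] ->
  exists2 i, (i < N)%N & Y `<=` A i.
Proof.
move=> [[y Yy] Yirr]; elim: N => [_ /(_ y Yy)[]//|N IHN Acl YA].
have Acl' i : (i < N)%N -> zariski_closed (A i) by move=> iN; apply: Acl; apply: ltnW.
have [|YA'|YAN] := Yirr _ _ (zariski_closed_cover Acl') (Acl N (ltnSn N)).
- move=> x /YA[] i; rewrite ltnS leq_eqVlt => /predU1P[->|iN] Aix; first by right.
  by left; exists i.
- by have [i iN YAi] := IHN Acl' YA'; exists i => //; apply: ltnW.
- by exists N.
Qed.

Lemma sub_zariski_closure A : A `<=` zariski_closure A.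
Proof. by move=> x Ax f; apply. Qed.

Lemma zariski_closure_sub A Z : zariski_closed Z -> A `<=` Z -> zariski_closure A `<=` Z.
Proof. by move=> [I ->] AZ x clx f If; apply: clx => y /AZ; apply. Qed.

Lemma zariski_closure_id Z : zariski_closed Z -> zariski_closure Z = Z.
Proof.
by move=> Zcl; apply/seteqP; split;
  [apply: zariski_closure_sub | apply: sub_zariski_closure].
Qed.

Lemma zariski_closed1 (x : 'I_n -> K) : zariski_closed [set x].
Proof.
exists [set f | exists i, f = 'X_i - (x i)%:MP]; apply/seteqP; split=> y.
  by move=> -> _ [i ->]; rewrite mevalB mevalXU mevalC subrr.
move=> h; apply/funext => i; apply/eqP; rewrite -subr_eq0.
by rewrite -[y i](mevalXU y) -[x i](mevalC y) -mevalB; apply/eqP/h; exists i.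
Qed.

Lemma irreducible1 (x : 'I_n -> K) : irreducible [set x].
Proof.
split=> [|A B _ _ /(_ x erefl)[Ax|Bx]]; first by exists x.
  by left=> _ ->.
by right=> _ ->.
Qed.

(** The differential of [f] at [x] in the direction [v], the form that cuts out [tangent_space]. *)
Definition tangent_form f (x v : 'I_n -> K) : K := \sum_i (mderiv i f).@[x] * v i.

Lemma tangent_formD f g x v :
  tangent_form (f + g) x v = tangent_form f x v + tangent_form g x v.
Proof.
rewrite /tangent_form -big_split; apply: eq_bigr => i _ /=.
by rewrite mderivD mevalD mulrDl.
Qed.

Lemma tangent_formM f g x v :
  tangent_form (f * g) x v = tangent_form f x v * g.@[x] + f.@[x] * tangent_form g x v.
Proof.
rewrite /tangent_form mulr_suml mulr_sumr -big_split; apply: eq_bigr => i _ /=.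
by rewrite mderivM mevalD !mevalM; ring.
Qed.

Lemma tangent_formC c x v : tangent_form c%:MP x v = 0.
Proof. by rewrite /tangent_form big1 // => i _; rewrite mderivC meval0 mul0r. Qed.

Lemma tangent_formZ c f x v : tangent_form (c *: f) x v = c * tangent_form f x v.
Proof. by rewrite -mul_mpolyC tangent_formM tangent_formC mevalC mul0r add0r. Qed.

Lemma tangent_formX k x v : tangent_form 'X_k x v = v k.
Proof.
rewrite /tangent_form (bigD1 k) //= mderivX mnm1E eqxx scale1r.
have -> : (U_(k) - U_(k))%MM = 0%MM by apply/mnmP => j; rewrite mnmBE subnn mnm0E.
rewrite mpolyX0 meval1 mul1r big1 ?addr0 // => i ik.
by rewrite mderivX mnm1E eq_sym (negPf ik) scale0r meval0 mul0r.
Qed.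

Lemma mpoly_alg_ind (P : {mpoly K[n]} -> Prop) :
  (forall c, P c%:MP) -> (forall i, P 'X_i) ->
  (forall f g, P f -> P g -> P (f + g)) -> (forall f g, P f -> P g -> P (f * g)) ->
  forall f, P f.
Proof.
move=> PC PX PD PM f; rewrite (mpolyE f).
apply: big_ind => [||m _]; [by rewrite -mpolyC0 | exact: PD |].
rewrite -mul_mpolyC; apply: (PM) => //; rewrite mpolyXE_id.
apply: big_ind => [||i _]; [by rewrite -mpolyC1 | exact: PM |].
by elim: (m i) => [|k IHk]; rewrite ?expr0 -?mpolyC1 // exprS; apply: (PM).
Qed.

End ZariskiTopology.

(** * Curves parametrized by fractions with a common denominator *)

Section RationalCurve.
Variables (K : numClosedFieldType) (n : nat) (g : 'I_n -> {poly K}) (h : {poly K}).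
Hypothesis h_neq0 : h != 0.

Definition curve_point (t : K) : 'I_n -> K := fun i => (g i).[t] / h.[t].

Definition curve_velocity (t : K) : 'I_n -> K :=
  fun i => ((g i)^`().[t] * h.[t] - (g i).[t] * h^`().[t]) / h.[t] ^+ 2.

Definition rational_curve : set ('I_n -> K) :=
  [set x | exists2 t, h.[t] != 0 & x = curve_point t].

Lemma poly_eq0_inj (P : {poly K}) (u : nat -> K) :
  injective u -> (forall m, P.[u m] = 0) -> P = 0.
Proof.
move=> u_inj Pu; apply/eqP; apply: contraT => P0.
have := max_poly_roots (rs := [seq u m | m <- iota 0 (size P)]) P0.
rewrite size_map size_iota ltnn; apply.
  by apply/allP => _ /mapP[m _ ->]; apply/rootP.
by rewrite map_inj_uniq // iota_uniq.
Qed.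

Lemma poly_eq0_all (P : {poly K}) : (forall t, P.[t] = 0) -> P = 0.
Proof.
move=> P0; apply: (poly_eq0_inj (u := fun m => m%:R)) => [i j /eqP|m]; last exact: P0.
by rewrite eqr_nat => /eqP.
Qed.

(** Dividing by [h] instead of writing [h^(N - 1)] avoids a separate case [N = 0]. *)
Lemma deriv_horner_exp (N : nat) t : h.[t] != 0 ->
  (h ^+ N)^`().[t] = h.[t] ^+ N * (N%:R * h^`().[t] / h.[t]).
Proof.
move=> ht; elim: N => [|N IHN]; first by rewrite expr0 derivC horner0; ring.
rewrite exprS derivM hornerD !hornerM IHN horner_exp -natr1 exprS; field.
by rewrite ht.
Qed.

(* Clearing denominators only with powers of [h], so that the derivative of the
   pullback computes the tangent form of [f] modulo [f] itself. *)
Lemma pullback (f : {mpoly K[n]}) : exists (N : nat) (F : {poly K}), forall t,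
  h.[t] != 0 ->
  F.[t] = h.[t] ^+ N * f.@[curve_point t] /\
  F^`().[t] = h.[t] ^+ N *
    (tangent_form f (curve_point t) (curve_velocity t) +
     N%:R * h^`().[t] / h.[t] * f.@[curve_point t]).
Proof.
elim/mpoly_alg_ind: f => [c|i|f1 f2 [N1 [F1 F1E]] [N2 [F2 F2E]]|
                          f1 f2 [N1 [F1 F1E]] [N2 [F2 F2E]]].
- exists 0%N, c%:P => t ht.
  by rewrite hornerC derivC horner0 mevalC tangent_formC; split; ring.
- exists 1%N, (g i) => t ht.
  rewrite mevalXU tangent_formX /curve_point /curve_velocity.
  by split; field; rewrite ht.
- exists (N1 + N2)%N, (F1 * h ^+ N2 + F2 * h ^+ N1) => t ht.
  have [E1 D1] := F1E t ht; have [E2 D2] := F2E t ht.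
  rewrite derivD !derivM !hornerD !hornerM D1 D2 !deriv_horner_exp // !horner_exp.
  by  rewrite E1 E2 mevalD tangent_formD natrD exprD; split; field; rewrite ?ht.
- exists (N1 + N2)%N, (F1 * F2) => t ht.
  have [E1 D1] := F1E t ht; have [E2 D2] := F2E t ht.
  rewrite derivM hornerD !hornerM D1 D2 E1 E2 mevalM tangent_formM natrD exprD.
  by split; field; rewrite ?ht.
Qed.

(** [F] is the pullback of [f], so [f] vanishes at only finitely many parameters. *)
Lemma pullback_neq0 f x : rational_curve x -> f.@[x] != 0 ->
  exists2 F : {poly K}, F != 0 &
    forall t, h.[t] != 0 -> f.@[curve_point t] = 0 -> F.[t] = 0.
Proof.
move=> [t ht ->] ft; have [N [F FE]] := pullback f; exists F.
  apply/eqP => F0; have [/esym/eqP] := FE t ht.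
  by rewrite F0 horner0 mulf_eq0 expf_eq0 (negPf ht) (negPf ft) andbF.
by move=> s hs fs; have [-> _] := FE s hs; rewrite fs mulr0.
Qed.

(** The pullback of [f] is the zero polynomial, hence so is its derivative, which up to a power of
    [h] is the tangent form plus a multiple of the value of [f]. *)
Lemma rational_curve_tangent f t : vanishing_ideal rational_curve f ->
  h.[t] != 0 -> tangent_form f (curve_point t) (curve_velocity t) = 0.
Proof.
move=> If ht; have [N [F FE]] := pullback f.
have fs s : h.[s] != 0 -> f.@[curve_point s] = 0 by move=> hs; apply: If; exists s.
have F0 : F = 0.
  suff /eqP : F * h = 0 by rewrite mulf_eq0 (negPf h_neq0) orbF => /eqP.
  apply: poly_eq0_all => s; rewrite hornerM.
  have [->|hs] := eqVneq h.[s] 0; first by rewrite mulr0.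
  by have [-> _] := FE s hs; rewrite fs // mulr0 mul0r.
have [_ /esym/eqP] := FE t ht; rewrite F0 deriv0 horner0 fs // mulr0 addr0.
by rewrite mulf_eq0 expf_eq0 (negPf ht) andbF => /eqP.
Qed.

Lemma exists_good_param (F : {poly K}) : F != 0 -> exists2 t, h.[t] != 0 & F.[t] != 0.
Proof.
move=> F0; apply: contrapT => bad.
have /eqP : F * h = 0.
  apply: poly_eq0_all => t; rewrite hornerM.
  have [->|ht] := eqVneq h.[t] 0; first by rewrite mulr0.
  have [->|Ft] := eqVneq F.[t] 0; first by rewrite mul0r.
  by case: bad; exists t.
by rewrite mulf_eq0 (negPf h_neq0) (negPf F0).
Qed.

(** If neither closed set contains the curve, each has an equation with nonzero pullback; a
    parameter avoiding the roots of both gives a point in neither set. *)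
Lemma irreducible_rational_curve : irreducible rational_curve.
Proof.
split.
  by have [t ht _] := exists_good_param h_neq0; exists (curve_point t), t.
move=> A B [I ->] [J ->] YAB; apply: contrapT.
move=> /not_orP[/existsNP[x /not_implyP[Yx /existsNP[f /not_implyP[If /eqP f0]]]]].
move=> /existsNP[y /not_implyP[Yy /existsNP[k /not_implyP[Jk /eqP k0]]]].
have [F F0 FE] := pullback_neq0 Yx f0; have [G G0 GE] := pullback_neq0 Yy k0.
have [t ht] := exists_good_param (mulf_neq0 F0 G0).
rewrite hornerM mulf_eq0 negb_or => /andP[/eqP Ft /eqP Gt].
have [/(_ f If)|/(_ k Jk)] := YAB (curve_point t) (ex_intro2 _ _ t ht erefl).
  by move/(FE _ ht).
by move/(GE _ ht).
Qed.

(** Some equation of [Z] has nonzero pullback, so [Z] lies in the finite set of points at its roots;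
    irreducibility leaves one. *)
Lemma proper_irreducible_rational_curve Z : zariski_closed Z -> irreducible Z ->
  Z `<` rational_curve -> exists x, Z = [set x].
Proof.
move=> [I ZE] Zirr [ZY /existsNP[x /not_implyP[Yx]]].
rewrite {1}ZE => /existsNP[f /not_implyP[If /eqP f0]].
have [F F0 FE] := pullback_neq0 Yx f0.
have [s sF] := closed_field_poly_normal F.
(* Roots of [F] where [h] vanishes give meaningless points, division by zero being zero; they are
   harmless in a cover. *)
pose A i := [set curve_point (nth 0 s i)] : set ('I_n -> K).
have [i _ ZAi] : exists2 i, (i < size s)%N & Z `<=` A i.
  apply: irreducible_cover => // [i _|z Zz]; first exact: zariski_closed1.
  have [t ht zE] := ZY z Zz.
  have /(FE t ht)/eqP : f.@[curve_point t] = 0 by rewrite -zE; move: Zz; rewrite ZE; apply.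
  rewrite sF hornerZ mulf_eq0 lead_coef_eq0 (negPf F0) /= horner_prod.
  rewrite prodf_seq_eq0 => /hasP[r rs]; rewrite hornerXsubC subr_eq0 => /eqP tr.
  exists (index r s); first by rewrite index_mem.
  by rewrite /A nth_index // -tr.
exists (curve_point (nth 0 s i)); apply/seteqP; split=> //.
by have [[z Zz] _] := Zirr; move=> _ ->; rewrite -(ZAi _ Zz).
Qed.

(** In a chain of length 2 the middle term would be a single point, with no nonempty proper subset
    below it. *)
Lemma has_dim_rational_curve x y : zariski_closed rational_curve ->
  rational_curve x -> rational_curve y -> x <> y -> has_dim rational_curve 1.
Proof.
move=> Ycl Yx Yy xy; split.
  exists (fun i => if i == 0%N then [set x] else rational_curve); split=> [[|i] _|[|i] //].
  - by split; [exact: zariski_closed1 | exact: irreducible1 | move=> _ ->].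
  - by split=> //; exact: irreducible_rational_curve.
  - by move=> _ /=; split=> [_ -> //|/(_ y Yy)/esym].
move=> [Z [ZP Zlt]]; have [_ _ Z2] := ZP 2%N isT; have [Z1cl Z1irr _] := ZP 1%N isT.
have [z Z1E] : exists z, Z 1%N = [set z].
  have [Z12 nZ21] := Zlt 1%N isT; apply: proper_irreducible_rational_curve => //.
  by split; [exact: subset_trans Z12 Z2 | move/(subset_trans Z2)].
have [_ [[w Zw] _] _] := ZP 0%N isT; have [Z01 nZ10] := Zlt 0%N isT.
by apply: nZ10; rewrite Z1E => _ ->; have := Z01 w Zw; rewrite Z1E => <-.
Qed.

(** The last hypothesis bounds the tangent space by the line of the velocity;
    [rational_curve_tangent] is the other inclusion. *)
Lemma smooth_rational_curve x y : zariski_closed rational_curve ->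
  rational_curve x -> rational_curve y -> x <> y ->
  (forall t, h.[t] != 0 -> exists2 i, curve_velocity t i != 0 &
    forall v : 'rV[K]_n, tangent_space rational_curve (curve_point t) v ->
      exists c, forall i, v 0 i = c * curve_velocity t i) ->
  smooth rational_curve.
Proof.
move=> Ycl Yx Yy xy tan; exists 1%N; first exact: has_dim_rational_curve Yx Yy xy.
move=> _ [t ht ->]; have [i wi tanP] := tan t ht.
pose w := \row_i curve_velocity t i; exists <[w]>%VS; last first.
  rewrite dim_vline; suff -> : w != 0 by [].
  by apply: contra_neq wi => /rowP/(_ i); rewrite !mxE.
apply/seteqP; split=> v.
  move=> /tanP[c vE]; apply/vlineP; exists c.
  by apply/rowP => k; rewrite vE !mxE.
move=> /vlineP[c ->] f If.
transitivity (c * tangent_form f (curve_point t) (curve_velocity t)).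
  by rewrite mulr_sumr; apply: eq_bigr => k _; rewrite !mxE mulrCA.
by rewrite rational_curve_tangent // mulr0.
Qed.

End RationalCurve.

(** * The curves of the frieze variety *)

Section Hyperbola.
Variables (C : numClosedFieldType) (n : nat) (a b : 'I_n -> C).

Lemma hyperbolaE :
  hyperbola a b = rational_curve (fun i => a i *: 'X^2 + (b i)%:P) 'X.
Proof.
by apply/seteqP; split=> x [t t0 ->]; exists t; rewrite ?hornerX // in t0 *;
  apply/funext => i; rewrite /curve_point !hornerE.
Qed.

Lemma irreducible_hyperbola : irreducible (hyperbola a b).
Proof. by rewrite hyperbolaE; apply: irreducible_rational_curve; rewrite polyX_eq0. Qed.

Section NonDegenerate.
Variables (j k : 'I_n).
Local Notation D := (a j * b k - a k * b j).
Hypothesis D0 : D != 0.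

(* On the hyperbola these two linear forms take the values [- D / t] and [D * t]. *)
Let U (x : 'I_n -> C) := a k * x j - a j * x k.
Let W (x : 'I_n -> C) := b k * x j - b j * x k.

Definition linear_form (c : 'I_n -> C) : {mpoly C[n]} := c k *: 'X_j - c j *: 'X_k.

Lemma linear_formE (c x : 'I_n -> C) : (linear_form c).@[x] = c k * x j - c j * x k.
Proof. by rewrite mevalB !mevalZ !mevalXU. Qed.

Lemma linear_form_tangent (c x v : 'I_n -> C) :
  tangent_form (linear_form c) x v = c k * v j - c j * v k.
Proof. by rewrite /linear_form -scaleN1r tangent_formD !tangent_formZ !tangent_formX; ring. Qed.

(** The parameter is recovered as [W x / D], nonzero since [U W] is. Thus polynomial equations
    describe the curve, which is already closed. *)
Lemma hyperbolaP (x : 'I_n -> C) : hyperbola a b x <->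
  U x * W x = - D ^+ 2 /\ forall i, x i = (a i * W x - b i * U x) / D.
Proof.
split=> [[t t0 ->]|[UW xE]].
  by split=> [|i]; rewrite /U /W; field; rewrite ?t0 ?D0.
have W0 : W x != 0.
  apply: contra_neq D0 => W0; apply/eqP.
  by rewrite -[D == 0]sqrf_eq0 -oppr_eq0 -UW W0 mulr0.
exists (W x / D); first by rewrite mulf_neq0 ?invr_eq0.
apply/funext => i; rewrite {1}xE.
have -> : U x = - D ^+ 2 / W x by rewrite -UW mulfK.
by field; rewrite W0 D0.
Qed.

Definition hyperbola_eqn : {mpoly C[n]} := linear_form a * linear_form b + (D ^+ 2)%:MP.
Definition hyperbola_lin i : {mpoly C[n]} :=
  D *: 'X_i - a i *: linear_form b + b i *: linear_form a.

Lemma hyperbola_eqn_vanish : vanishing_ideal (hyperbola a b) hyperbola_eqn.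
Proof.
move=> x /hyperbolaP[UW _].
by rewrite mevalD mevalM !linear_formE mevalC -/(U x) -/(W x) UW addNr.
Qed.

Lemma hyperbola_lin_vanish i : vanishing_ideal (hyperbola a b) (hyperbola_lin i).
Proof.
move=> x /hyperbolaP[_ xE].
rewrite mevalD mevalB !mevalZ mevalXU !linear_formE {1}xE /U /W.
by rewrite mulrCA mulfV // mulr1; ring.
Qed.

Lemma zariski_closed_nondegenerate_hyperbola : zariski_closed (hyperbola a b).
Proof.
exists (vanishing_ideal (hyperbola a b)); apply/seteqP; split=> x.
  by move=> Hx f; apply.
move=> xI; apply/hyperbolaP; split=> [|i].
  apply/eqP; rewrite -addr_eq0; apply/eqP.
  have := xI _ hyperbola_eqn_vanish.
  by rewrite mevalD mevalM !linear_formE mevalC.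
have := xI _ (hyperbola_lin_vanish i).
rewrite mevalD mevalB !mevalZ mevalXU !linear_formE -/(U x) -/(W x) => /eqP.
rewrite addr_eq0 subr_eq => /eqP xE; apply: (mulfI D0).
by rewrite xE mulrCA mulfV // mulr1 addrC.
Qed.

Lemma smooth_nondegenerate_hyperbola : smooth (hyperbola a b).
Proof.
have cl := zariski_closed_nondegenerate_hyperbola; move: cl; rewrite hyperbolaE => cl.
pose pt := curve_point (fun i => a i *: 'X^2 + (b i)%:P) 'X.
have ptE t i : pt t i = (a i * t ^+ 2 + b i) / t by rewrite /pt /curve_point !hornerE.
have WE t : t != 0 -> W (pt t) = D * t by move=> t0; rewrite /W !ptE; field.
have UE t : t != 0 -> U (pt t) = - D / t by move=> t0; rewrite /U !ptE; field.
have two0 : 2 != 0 :> C by rewrite pnatr_eq0.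
(* The points at 1 and 2 differ because [W] is [D] at one and [2 D] at the other. *)
apply: (@smooth_rational_curve _ _ _ _ _ (pt 1) (pt 2)) => //.
- by rewrite polyX_eq0.
- by exists 1 => //; rewrite hornerX oner_eq0.
- by exists 2 => //; rewrite hornerX.
- move=> /(congr1 W); rewrite !WE ?oner_eq0 // => /(mulfI D0)/eqP.
  by rewrite (eqr_nat _ 1 2).
move=> t; rewrite hornerX => t0.
have velE i : curve_velocity (fun i => a i *: 'X^2 + (b i)%:P) 'X t i = a i - b i / t ^+ 2.
  rewrite /curve_velocity derivD derivZ derivXn derivC derivX addr0 !hornerE /=.
  by field.
have [i wi] : exists i, a i - b i / t ^+ 2 != 0.
  apply: contrapT => /forallNP vel0.
  have velz i : b i = a i * t ^+ 2.
    have /negP := vel0 i; rewrite negbK subr_eq0 => /eqP ->.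
    by rewrite divfK // expf_neq0.
  by move/eqP: D0; apply; rewrite !velz; ring.
exists i; first by rewrite velE.
move=> v; pose y r := v 0 r => vT.
suff : exists c, forall r, y r = c * (a r - b r / t ^+ 2).
  by move=> [c yE]; exists c => r; rewrite velE; exact: yE.
have {vT} : forall f, vanishing_ideal (hyperbola a b) f -> tangent_form f (pt t) y = 0.
  by rewrite hyperbolaE => f; exact: vT.
(* [W] of the velocity is [D], the derivative of [D t], so the factor has to be [W y / D]. *)
move: y => y yT; exists (W y / D) => l.
have := yT _ hyperbola_eqn_vanish; rewrite /hyperbola_eqn tangent_formD tangent_formM tangent_formC.
rewrite !linear_form_tangent !linear_formE.
have := yT _ (hyperbola_lin_vanish l); rewrite /hyperbola_lin -scaleN1r 2!tangent_formD.
rewrite 4!tangent_formZ tangent_formX !linear_form_tangent.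
rewrite -/(U (pt t)) -/(W (pt t)) WE // UE //.
rewrite -/(U y) -/(W y).
move: (U _) (W _) => u w /eqP h1 /eqP h2.
(* This is the differential of [U W + D^2] at the point, where [U = - D / t] and [W = D t]. *)
have uE : u = w / t ^+ 2.
  have : D * t * (u - w / t ^+ 2) == 0.
    by apply/eqP; rewrite -[RHS](eqP h2); field.
  by rewrite mulf_eq0 (negPf (mulf_neq0 D0 t0)) subr_eq0 => /eqP.
move: h1; rewrite uE => h1; apply: (mulfI D0).
apply/eqP; rewrite -subr_eq0; apply/eqP; rewrite -[RHS](eqP h1); field.
by rewrite t0 D0.
Qed.

(** Project to [(x_j, x_k)]; by [hyperbolaP] the other coordinates are linear in these two. The
    image is [U W + D^2 = 0], of degree exactly 2 because [a k] and [b k] keep both linear forms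
    nonzero. *)
Lemma hyperbola_isomorphic_conic : a k != 0 -> b k != 0 ->
  exists2 Z : set ('I_2 -> C), plane_conic Z & isomorphic (hyperbola a b) Z.
Proof.
move=> ak0 bk0; pose i0 : 'I_2 := ord0; pose i1 : 'I_2 := ord_max.
pose L2 (c : 'I_n -> C) : {mpoly C[2]} := c k *: 'X_i0 - c j *: 'X_i1.
have L2E c z : (L2 c).@[z] = c k * z i0 - c j * z i1.
  by rewrite mevalB !mevalZ !mevalXU.
pose F := L2 a * L2 b + (D ^+ 2)%:MP.
have FE z : F.@[z] = (a k * z i0 - a j * z i1) * (b k * z i0 - b j * z i1) + D ^+ 2.
  by rewrite mevalD mevalM mevalC !L2E.
exists (zero_locus [set F]).
  exists F => //.
  have L2sz c : c k != 0 -> msize (L2 c) = 2%N.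
    move=> ck0; apply/eqP; rewrite eqn_leq; apply/andP; split.
      rewrite (leq_trans (msizeD_le _ _)) // geq_max msizeN.
      by rewrite !(leq_trans (msizeZ_le _ _)) // msizeX mdeg1.
    rewrite -[X in (X < _)%N](mdeg1 i0); apply: msize_mdeg_lt.
    rewrite mcoeff_msupp mcoeffB !mcoeffZ !mcoeffX eqxx eq_mnm1.
    by rewrite mulr1 mulr0 subr0.
  have L20 c : c k != 0 -> L2 c != 0.
    by move=> ck0; rewrite -(msize_poly_eq0 (L2 c)) L2sz.
  have szM : msize (L2 a * L2 b) = 3%N by rewrite msizeM ?L20 // !L2sz.
  have szC : (msize ((D ^+ 2)%:MP : {mpoly C[2]}) <= 1)%N by rewrite msizeC leq_b1.
  apply/eqP; rewrite eqn_leq; apply/andP; split.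
    by rewrite (leq_trans (msizeD_le _ _)) // geq_max szM (leq_trans szC).
  have : (msize (F - (D ^+ 2)%:MP) <= maxn (msize F) 1)%N.
    by rewrite (leq_trans (msizeD_le _ _)) // geq_max leq_maxl msizeN leq_max szC orbT.
  by rewrite addrK szM leq_max orbF.
exists (fun i => if i == i0 then 'X_j else 'X_k).
exists (fun i => D^-1 *: (a i *: L2 b - b i *: L2 a)).
have proj x : polymap (fun i : 'I_2 => if i == i0 then 'X_j else 'X_k : {mpoly C[n]}) x =
              fun i => if i == i0 then x j else x k.
  by apply/funext => i; rewrite /polymap; case: eqP => _; rewrite mevalXU.
have lift_ z i : polymap (fun i => D^-1 *: (a i *: L2 b - b i *: L2 a)) z i =
   (a i * (b k * z i0 - b j * z i1) - b i * (a k * z i0 - a j * z i1)) / D.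
  by rewrite /polymap mevalZ mevalB !mevalZ !L2E mulrC.
split=> [x /hyperbolaP[UW _]|z /(_ F erefl)|x /hyperbolaP[_ xE]|z _].
- by rewrite proj => _ ->; rewrite FE /= -/(U x) -/(W x) UW addNr.
- rewrite FE => Fz; set x := polymap _ _.
  have xj : x j = z i0 by rewrite /x lift_; field.
  have xk : x k = z i1 by rewrite /x lift_; field.
  apply/hyperbolaP; split=> [|i]; rewrite /U /W xj xk ?[LHS]lift_ //.
  by apply/eqP; rewrite -addr_eq0 Fz.
- by rewrite proj; apply/funext => i; rewrite lift_ /= [RHS]xE.
- rewrite proj; apply/funext => i; case: eqP => [->|/eqP i0'].
    by rewrite lift_; field.
  have -> : i = i1 by apply: val_inj; case: i i0' => [[|[|[]]]].
  by rewrite lift_; field.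
Qed.

End NonDegenerate.
End Hyperbola.

(** * The degenerate case: lines through the origin *)

Section Line.
Variables (C : numClosedFieldType) (n : nat) (a : 'I_n -> C) (o : 'I_n).
Hypothesis a_o : a o != 0.

Definition origin_line : set ('I_n -> C) := [set x | exists s, x = fun i => a i * s].

Lemma origin_lineE : origin_line = rational_curve (fun i => a i *: 'X) 1.
Proof.
apply/seteqP; split=> x.
  move=> [s ->]; exists s; first by rewrite hornerC oner_eq0.
  by apply/funext => i; rewrite /curve_point !hornerE divr1.
move=> [s _ ->]; exists s; apply/funext => i.
by rewrite /curve_point !hornerE divr1.
Qed.

Lemma origin_line_eqn (i : 'I_n) :
  vanishing_ideal origin_line (a o *: 'X_i - a i *: 'X_o).
Proof. by move=> _ [s ->]; rewrite mevalB !mevalZ !mevalXU; ring. Qed.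

Lemma zariski_closed_origin_line : zariski_closed origin_line.
Proof.
exists (vanishing_ideal origin_line); apply/seteqP; split=> x; first by move=> Lx f; apply.
move=> Ix; exists (x o / a o); apply/funext => i.
have := Ix _ (origin_line_eqn i); rewrite mevalB !mevalZ !mevalXU => /eqP.
by rewrite subr_eq0 => /eqP xi; rewrite mulrA -xi mulrAC mulfV // mul1r.
Qed.

Lemma origin_line_isomorphic : isomorphic origin_line (@affine_line C).
Proof.
exists (fun=> (a o)^-1 *: 'X_o), (fun i => a i *: 'X_ord0).
split=> [//|z _|_ [s ->]|z _].
- by exists (z ord0); apply/funext => i; rewrite /polymap mevalZ mevalXU.
- by apply/funext => i; rewrite /polymap !(mevalZ, mevalXU); field.
- apply/funext => i; rewrite /polymap !(mevalZ, mevalXU) (ord1 i).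
  by rewrite mulKf.
Qed.

Lemma smooth_origin_line : smooth origin_line.
Proof.
have cl := zariski_closed_origin_line; have eqn := origin_line_eqn.
rewrite origin_lineE in cl eqn *.
have mem s : rational_curve (fun i => a i *: 'X) 1 (fun i => a i * s).
  by rewrite -origin_lineE; exists s.
have vel t i : curve_velocity (fun i => a i *: 'X) 1 t i = a i.
  by rewrite /curve_velocity derivZ derivX derivC !hornerE; field.
apply: (@smooth_rational_curve _ _ _ _ _ _ _ cl (mem 0) (mem 1)) => [|/(congr1 (@^~ o))|t _].
- exact: oner_neq0.
- by rewrite mulr0 mulr1 => /esym/eqP; rewrite (negPf a_o).
exists o => [|v vT]; first by rewrite vel.
exists (v 0 o / a o) => i; rewrite vel.
have : tangent_form (a o *: 'X_i - a i *: 'X_o)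
    (curve_point (fun i => a i *: 'X) 1 t) (fun i => v 0 i) = 0 by exact: vT.
rewrite -scaleN1r tangent_formD !tangent_formZ !tangent_formX mulN1r => /eqP.
by rewrite subr_eq0 => /eqP vi; apply: (mulfI a_o); rewrite vi; field.
Qed.

(** Here [b = c a] with [c != 0], so the points are [a] times [t + c / t], which takes every value
    on nonzero [t]. *)
Lemma degenerate_hyperbola (b : 'I_n -> C) :
  (forall i, a i != 0) -> (forall i, b i != 0) ->
  (forall j k, a j * b k - a k * b j = 0) -> hyperbola a b = origin_line.
Proof.
move=> a0 b0 D0; pose c := b o / a o.
have bE k : b k = a k * c.
  have /eqP := D0 o k; rewrite subr_eq0 => /eqP h; apply: (mulfI a_o).
  by rewrite h /c; field.
have c0 : c != 0 by rewrite mulf_neq0 ?invr_eq0.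
apply/seteqP; split=> x [t].
  by move=> t0 ->; exists (t + c / t); apply/funext => i; rewrite bE; field.
(* [(t + r) / 2] solves [z^2 - t z + c = 0]; it is nonzero because [c] is. *)
move=> ->; pose r := sqrtC (t ^+ 2 - 4 * c).
have rE : r ^+ 2 = t ^+ 2 - 4 * c by rewrite sqrtCK.
have sE : ((t + r) / 2) ^+ 2 + c = (t + r) / 2 * t.
  have -> : ((t + r) / 2) ^+ 2 = (t ^+ 2 + 2 * t * r + r ^+ 2) / 4 by field.
  by rewrite rE; field.
have s0 : (t + r) / 2 != 0.
  by apply: contra_neq c0 => s0; move: sE; rewrite s0 expr0n add0r mul0r.
move: (_ / 2) s0 sE => z z0 zE; exists z => //; apply/funext => i.
by rewrite bE -mulrDr zE; field.
Qed.

End Line.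

Section Components.
Variables (C : numClosedFieldType) (n : nat) (a b : 'I_n -> C).
Hypotheses (n_gt0 : (0 < n)%N) (ab0 : forall i, a i != 0 /\ b i != 0).

Lemma hyperbola_cases :
  (exists j k, a j * b k - a k * b j != 0) \/ hyperbola a b = origin_line a.
Proof.
have [h|h] := pselect (exists j k, a j * b k - a k * b j != 0); [by left | right].
apply: (degenerate_hyperbola (o := Ordinal n_gt0)) => [|i|i|j k].
- by have [] := ab0 (Ordinal n_gt0).
- by have [] := ab0 i.
- by have [] := ab0 i.
- by apply/eqP; apply: contraT => D0; case: h; exists j, k.
Qed.

Lemma zariski_closed_hyperbola : zariski_closed (hyperbola a b).
Proof.
have [[j [k D0]]|->] := hyperbola_cases; first exact: zariski_closed_nondegenerate_hyperbola D0.
by apply: (@zariski_closed_origin_line _ _ _ (Ordinal n_gt0)); case: (ab0 (Ordinal n_gt0)).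
Qed.

(** The pullback of a polynomial vanishing on [S] has infinitely many roots [u m], so the polynomial
    vanishes on the whole curve. *)
Lemma hyperbola_sub_closure (S : set ('I_n -> C)) (u : nat -> C) :
  injective u -> (forall m, u m != 0) ->
  (forall m, S (fun i => (a i * u m ^+ 2 + b i) / u m)) ->
  hyperbola a b `<=` zariski_closure S.
Proof.
move=> u_inj u0 Su x Yx f If; apply/eqP; apply: contraT => fx.
rewrite hyperbolaE in Yx; have [F F0 FE] := pullback_neq0 Yx fx.
case/eqP: F0; apply: (poly_eq0_inj u_inj) => m; apply: FE; first by rewrite hornerX.
rewrite -[RHS](If _ (Su m)); apply: meval_eq => i.
by rewrite /curve_point !hornerE.
Qed.

End Components.

(** The closed irreducible curves of the [p q] residues of the time lie in the variety and cover it.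
    So [Y] lies in one of them, and maximality gives equality. *)
Lemma frieze_variety_component (C : numClosedFieldType) (p q : nat)
    (Y : set ('I_(p + q) -> C)) : (0 < p)%N -> (0 < q)%N ->
  irreducible_component (frieze_variety C (Atilde p q)) Y ->
  exists a b : 'I_(p + q) -> C, (forall i, a i != 0 /\ b i != 0) /\ Y = hyperbola a b.
Proof.
move=> p0 q0 [Ycl Yirr YX Ymax]; have n0 : (0 < p + q)%N by rewrite addn_gt0 p0.
have [l l_inj [l0 closed_form]] := frieze_closed_form C p0 q0.
have [a ab] := choice closed_form; have [b {ab}abE] := choice ab.
pose A r := hyperbola (a r) (b r).
have Acl r : zariski_closed (A r).
  by apply: zariski_closed_hyperbola => //; case: (abE r).
have AX r : A r `<=` frieze_variety C (Atilde p q).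
  apply: (hyperbola_sub_closure l_inj) => [m|m]; first exact: expf_neq0.
  exists (r + p * q * m)%N; apply/funext => i.
  by have [_ ->] := abE r.
have pq0 : (0 < p * q)%N by rewrite muln_gt0 p0.
have [r _ YA] : exists2 r, (r < p * q)%N & Y `<=` A r.
  apply: irreducible_cover => //; apply: subset_trans YX _.
  apply: zariski_closure_sub; first by apply: zariski_closed_cover => r _.
  move=> _ [t ->]; exists (t %% (p * q))%N; first exact: ltn_pmod.
  exists (l ^+ (t %/ (p * q))); first exact: expf_neq0.
  apply/funext => i; have [_ <-] := abE (t %% (p * q))%N.
  have -> // : (t %% (p * q) + p * q * (t %/ (p * q)))%N = t.
  by rewrite addnC mulnC -divn_eq.
exists (a r), (b r); split; first by have [] := abE r.
by rewrite -(Ymax (A r)) //; exact: irreducible_hyperbola.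
Qed.

(** * The lexicographic Groebner basis *)

Section LexOrder.
Variable n : nat.
Implicit Types (s r : seq 'I_n) (m : 'X_{1..n}).

Lemma lex_le_refl s m : lex_le s m m.
Proof. exact: lexx. Qed.

Lemma lex_le_cons i s m1 m2 :
  lex_le (i :: s) m1 m2 = (m1 i <= m2 i)%N && ((m2 i <= m1 i)%N ==> lex_le s m1 m2).
Proof. by rewrite /lex_le /= lexi_cons. Qed.

(** The elimination property of the lexicographic order, [s] being the largest variables. *)
Lemma lex_le_zero_prefix s r m1 m2 : (forall i, i \in s -> m2 i = 0%N) ->
  lex_le (s ++ r) m1 m2 -> (forall i, i \in s -> m1 i = 0%N) /\ lex_le r m1 m2.
Proof.
elim: s => [//|i s IHs] m20; rewrite lex_le_cons m20 ?mem_head // leqn0.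
move=> /andP[/eqP m1i]; rewrite m1i /= => /IHs[k ks|m10 ?].
  by rewrite m20 // in_cons ks orbT.
by split=> // k; rewrite in_cons => /predU1P[->|/m10].
Qed.

Lemma lex_le_prefix s i r m1 m2 : (forall k, k \in s -> m1 k = m2 k) ->
  (m1 i < m2 i)%N -> lex_le (s ++ i :: r) m1 m2.
Proof.
elim: s => [_ mi|k s IHs m12 mi]; first by rewrite lex_le_cons ltnW //= leqNgt mi.
rewrite cat_cons lex_le_cons m12 ?mem_head // leqnn /=; apply: IHs => // l ls.
by rewrite m12 // in_cons ls orbT.
Qed.

End LexOrder.

Lemma first_last_vertex n (n_gt0 : (0 < n)%N) :
  (1 < n)%N -> first_vertex n_gt0 != last_vertex n_gt0.
Proof. by move=> n1; apply/eqP => /(congr1 val) /=; lia. Qed.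

Section ConicGroebner.
Variables (C : numClosedFieldType) (n : nat) (n_gt0 : (0 < n)%N) (n_gt1 : (1 < n)%N).
Variables (a b : 'I_n -> C).
Hypotheses (ab0 : forall i, a i != 0 /\ b i != 0) (alpha0 : alpha n_gt0 a b != 0).

Local Notation v1 := (first_vertex n_gt0).
Local Notation vn := (last_vertex n_gt0).
Local Notation L := (Lpoly n_gt0 a b).
Local Notation H := (Hpoly n_gt0 a b).
Local Notation I := (vanishing_ideal (hyperbola a b)).
Local Notation al := (alpha n_gt0 a b).

Let mids := [seq k : 'I_n <- enum 'I_n | (0 < k < n.-1)%N].

Lemma mem_mids k : (k \in mids) = (0 < k < n.-1)%N.
Proof. by rewrite mem_filter mem_enum andbT. Qed.

Lemma lex_varsE : lex_vars n = mids ++ [:: vn; v1].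
Proof.
apply: (inj_map val_inj); rewrite /lex_vars map_rot val_enum_ord map_cat /= subn1.
rewrite -(filter_map val (fun x : nat => 0 < x < n.-1)%N) val_enum_ord.
have [m ->] : exists m, n = m.+2 by exists n.-2; case: n n_gt1 => [|[]].
have -> : iota 0 m.+2 = 0%N :: iota 1 m ++ [:: m.+1] by rewrite -[m.+2]addn1 iotaD.
rewrite rot1_cons /= filter_cat /= ltnn cats0 -cats1 -catA.
congr (_ ++ _); apply/esym/all_filterP/allP => x.
by rewrite mem_iota add1n.
Qed.

Lemma mids_v1 k : k \in mids -> k != v1.
Proof. by rewrite mem_mids => k0; apply/eqP => kE; move: k0; rewrite kE. Qed.

Lemma mids_vn k : k \in mids -> k != vn.
Proof.
by rewrite mem_mids => kn; apply/eqP => kE; move: kn; rewrite kE /= subn1 ltnn andbF.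
Qed.

Lemma Lpoly_vanish k : I (L k).
Proof.
move=> x [t t0 ->]; rewrite /Lpoly mevalB mevalD !mevalZ !mevalXU.
by rewrite /alpha; field; rewrite t0 alpha0.
Qed.

Lemma Hpoly_vanish : I H.
Proof.
move=> x [t t0 ->].
rewrite /Hpoly !expr2 !mevalD mevalN !mevalZ !mevalM !mevalXU mevalC.
by rewrite /alpha; field.
Qed.

(** A positive power of [x_k] dominates every monomial in [x_1] and [x_n] alone, whatever its
    degree. *)
Lemma lex_le_mids k (m1 m2 : 'X_{1..n}) : k \in mids ->
  (forall l, l \in mids -> m1 l = 0%N) -> (forall l, l != k -> m2 l = 0%N) ->
  (0 < m2 k)%N -> lex_le (lex_vars n) m1 m2.
Proof.
move=> kM m10 m20 m2k; rewrite lex_varsE.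
have : forall l, l \in mids -> m1 l = 0%N by [].
have : uniq mids by rewrite filter_uniq // enum_uniq.
case/path.splitPr: kM => s r; rewrite cat_uniq /= => /and3P[_ /norP[ks _] _] m1z.
rewrite -catA; apply: lex_le_prefix => [l ls|].
  rewrite m1z ?mem_cat ?ls // m20 //.
  by apply: contraNneq ks => <-.
by rewrite m1z // mem_cat mem_head orbT.
Qed.

Lemma lex_le_last (m1 m2 : 'X_{1..n}) :
  (forall l, l \in mids -> m1 l = m2 l) -> (m1 vn < m2 vn)%N ->
  lex_le (lex_vars n) m1 m2.
Proof. by move=> m12 mvn; rewrite lex_varsE; exact: lex_le_prefix. Qed.

Lemma Lpoly_leading k : k \in mids -> is_leading_monomial (lex_vars n) (L k) U_(k).
Proof.
move=> kM; have k1 := mids_v1 kM; have kn := mids_vn kM.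
have LE m : (L k)@_m = (U_(k)%MM == m)%:R
    + (a vn * b k - b vn * a k) / al * (U_(v1)%MM == m)%:R
    - (a v1 * b k - b v1 * a k) / al * (U_(vn)%MM == m)%:R.
  by rewrite /Lpoly mcoeffB mcoeffD !mcoeffZ !mcoeffX.
split.
  rewrite mcoeff_msupp LE eqxx !eq_mnm1 ![_ == k]eq_sym (negPf k1) (negPf kn).
  by rewrite !mulr0 addr0 subr0 oner_eq0.
have Uk l : l != k -> U_(k)%MM l = 0%N by rewrite mnm1E eq_sym => /negPf->.
have Uout i : i \notin mids -> forall l, l \in mids -> U_(i)%MM l = 0%N.
  by move=> iM l lM; rewrite mnm1E; case: eqP iM => // ->; rewrite lM.
have Uk1 : (0 < U_(k)%MM k)%N by rewrite mnm1E eqxx.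
have v1M : v1 \notin mids by apply/negP => /mids_v1; rewrite eqxx.
have vnM : vn \notin mids by apply/negP => /mids_vn; rewrite eqxx.
move=> m; rewrite mcoeff_msupp LE.
have [<- _|_] := eqVneq U_(k)%MM m; first exact: lex_le_refl.
have [<- _|_] := eqVneq U_(v1)%MM m; first exact: lex_le_mids kM (Uout _ v1M) Uk Uk1.
have [<- _|_] := eqVneq U_(vn)%MM m; first exact: lex_le_mids kM (Uout _ vnM) Uk Uk1.
by rewrite !mulr0 addr0 subr0 eqxx.
Qed.

(** [x_n] precedes [x_1], so [x_n^2] leads, with nonzero coefficient [a v1 * b v1]. *)
Lemma Hpoly_leading : is_leading_monomial (lex_vars n) H (U_(vn) + U_(vn))%MM.
Proof.
have v1n := first_last_vertex n_gt0 n_gt1.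
have HE m : H@_m = a vn * b vn * ((U_(v1) + U_(v1))%MM == m)%:R
    - (a v1 * b vn + a vn * b v1) * ((U_(v1) + U_(vn))%MM == m)%:R
    + a v1 * b v1 * ((U_(vn) + U_(vn))%MM == m)%:R + al ^+ 2 * (m == 0%MM)%:R.
  rewrite /Hpoly -/al !expr2 -!mpolyXD !mcoeffD mcoeffN !mcoeffZ !mcoeffX.
  by rewrite mcoeffC.
have out i l : i \in [:: v1; vn] -> l \in mids -> (i == l) = false.
  move=> iv lM; apply/eqP => il; move: iv; rewrite il !inE.
  by rewrite (negPf (mids_v1 lM)) (negPf (mids_vn lM)).
have at_vn i j : (U_(i) + U_(j))%MM vn = ((i == vn) + (j == vn))%N.
  by rewrite mnmDE !mnm1E.
have at_mids i j l : i \in [:: v1; vn] -> j \in [:: v1; vn] -> l \in mids ->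
    (U_(i) + U_(j))%MM l = 0%N.
  by move=> iv jv lM; rewrite mnmDE !mnm1E !out.
have v1i : v1 \in [:: v1; vn] by rewrite !inE eqxx.
have vni : vn \in [:: v1; vn] by rewrite !inE eqxx orbT.
split.
  have ne (m : 'X_{1..n}) : m vn != 2%N -> (m == (U_(vn) + U_(vn))%MM) = false.
    by move=> m2; apply/eqP => mE; move: m2; rewrite mE at_vn eqxx.
  rewrite mcoeff_msupp HE eqxx [_ == 0%MM]eq_sym.
  rewrite ne ?at_vn ?(negPf v1n) // ne ?at_vn ?(negPf v1n) ?eqxx // ne ?mnm0E //.
  rewrite !mulr0 subr0 add0r addr0 mulr1 mulf_neq0 //; first by have [] := ab0 v1.
  by have [] := ab0 v1.
move=> m; rewrite mcoeff_msupp HE.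
have [<- _|_] := eqVneq (U_(v1) + U_(v1))%MM m.
  by apply: lex_le_last => [l lM|]; [rewrite !at_mids | rewrite !at_vn (negPf v1n) eqxx].
have [<- _|_] := eqVneq (U_(v1) + U_(vn))%MM m.
  by apply: lex_le_last => [l lM|]; [rewrite !at_mids | rewrite !at_vn (negPf v1n) eqxx].
have [<- _|_] := eqVneq (U_(vn) + U_(vn))%MM m; first exact: lex_le_refl.
have [-> _|_] := eqVneq m 0%MM.
  by apply: lex_le_last => [l lM|]; rewrite mnm0E; [rewrite at_mids | rewrite at_vn eqxx].
by rewrite !mulr0 subr0 !addr0 eqxx.
Qed.

(** Independence of 1 and [x_n] over the polynomials in [x_1], modulo the ideal of the curve. *)
Lemma hyperbola_bivariate (P Q : {poly C}) :
  (forall x, hyperbola a b x -> P.[x v1] + Q.[x v1] * x vn = 0) -> P = 0 /\ Q = 0.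
Proof.
move=> PQ0; have [a0 b0] := ab0 v1.
(* A general value of [x_1] comes from two parameters with distinct [x_n]. *)
have PQt t : t != 0 -> P.[(a v1 * t ^+ 2 + b v1) / t] +
    Q.[(a v1 * t ^+ 2 + b v1) / t] * ((a vn * t ^+ 2 + b vn) / t) = 0.
  by move=> t0; apply: (PQ0 (fun i => (a i * t ^+ 2 + b i) / t)); exists t.
have two_roots z : exists t t' : C, [/\ t != 0, t' != 0,
    (a v1 * t ^+ 2 + b v1) / t = z, (a v1 * t' ^+ 2 + b v1) / t' = z &
    t * t' = b v1 / a v1 /\ ((t - t') * a v1) ^+ 2 = z ^+ 2 - 4 * (a v1 * b v1)].
  (* The parameters are the roots of [a_1 t^2 - z t + b_1], of discriminant [z^2 - 4 a_1 b_1]. *)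
  pose r := sqrtC (z ^+ 2 - 4 * (a v1 * b v1)).
  have rE : r ^+ 2 = z ^+ 2 - 4 * (a v1 * b v1) by rewrite sqrtCK.
  pose t := (z + r) / (2 * a v1); pose t' := (z - r) / (2 * a v1).
  have tt' : t * t' = b v1 / a v1.
    have -> : t * t' = (z ^+ 2 - r ^+ 2) / (4 * a v1 ^+ 2) by rewrite /t /t'; field.
    by rewrite rE; field.
  have : t * t' != 0 by rewrite tt' mulf_neq0 ?invr_eq0.
  rewrite mulf_eq0 negb_or => /andP[t0 t'0].
  have bE : b v1 = a v1 * (t * t') by rewrite tt'; field.
  have zE : z = a v1 * (t + t') by rewrite /t /t'; field.
  exists t, t'; split=> //; [by rewrite bE zE; field | by rewrite bE zE; field |].
  split=> //; rewrite -rE; congr (_ ^+ 2); rewrite /t /t'; field; exact: a0.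
have Q0 : Q = 0.
  (* The discriminant factor absorbs the values [z] at which the two parameters coincide. *)
  have /eqP : Q * ('X^2 - (4 * (a v1 * b v1))%:P) = 0.
    apply: poly_eq0_all => z; rewrite hornerM hornerD hornerN hornerXn hornerC.
    have [t [t' [t0 t'0 tz t'z [tt' dE]]]] := two_roots z.
    have := PQt t t0; have := PQt t' t'0; rewrite tz t'z => /eqP h' /eqP h.
    rewrite -dE; have bE : b v1 = a v1 * (t * t') by rewrite tt'; field.
    (* Subtract the relations at [t] and [t'], where the values of [x_n] differ by
       [- (t - t') al / b_1]. *)
    have : Q.[z] * ((t - t') * (- al / b v1)) == 0.
      apply/eqP; rewrite -[RHS](subrr 0) -[X in _ = X - _](eqP h) -[X in _ = _ - X](eqP h').
      have abv : a v1 * (t * t') != 0 by rewrite -bE.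
      rewrite /alpha bE; field.
      by rewrite a0 t0 t'0.
    rewrite mulf_eq0 => /orP[/eqP->|]; first by rewrite mul0r.
    rewrite mulf_eq0 mulf_eq0 oppr_eq0 invr_eq0 (negPf alpha0) (negPf b0) !orbF => /eqP->.
    by rewrite mul0r expr0n mulr0.
  by rewrite mulf_eq0 (negPf (monic_neq0 (monicXnsubC _ _))) // orbF => /eqP.
split=> //; apply: poly_eq0_all => z.
have [t [_ [t0 _ tz _ _]]] := two_roots z.
by have := PQt t t0; rewrite tz Q0 horner0 mul0r addr0.
Qed.

(* Otherwise all monomials of [f] are smaller than [x_n^2], so [f] is
   [P(x_1) + Q(x_1) x_n], which vanishes on the hyperbola only if [P = Q = 0]. *)
Lemma leading_monomial_reducible f m : I f -> is_leading_monomial (lex_vars n) f m ->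
  (exists2 k, k \in mids & (0 < m k)%N) \/ (1 < m vn)%N.
Proof.
move=> If [mf mmax]; apply: contrapT => /not_orP[nk /negP]; rewrite -leqNgt => mvn.
have m0 k : k \in mids -> m k = 0%N.
  by move=> kM; apply/eqP; rewrite eqn0Ngt; apply/negP => mk; apply: nk; exists k.
have supp m' : m' \in msupp f ->
    (forall k, k \in mids -> m' k = 0%N) /\ (m' vn <= 1)%N.
  move=> /mmax; rewrite lex_varsE => /(lex_le_zero_prefix m0)[m'0].
  by rewrite lex_le_cons => /andP[/leq_trans/(_ mvn)].
have outer i : (i != v1) && (i != vn) -> i \in mids.
  move=> /andP[iv1 ivn]; rewrite mem_mids lt0n.
  have := ltn_ord i; move: iv1 ivn; rewrite -!val_eqE /= subn1; lia.
(* [P e] collects the terms of degree [e] in [x_n], as a polynomial in [x_1]. *)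
pose P e := \sum_(m' <- msupp f | m' vn == e) f@_m' *: 'X^(m' v1).
have [P0 P1] : P 0%N = 0 /\ P 1%N = 0.
  apply: hyperbola_bivariate => x /If <-; rewrite mevalE.
  rewrite !horner_sum mulr_suml.
  rewrite [RHS](bigID (fun m' : 'X_{1..n} => m' vn == 0%N)) /=; congr (_ + _).
    rewrite big_seq_cond [RHS]big_seq_cond; apply: eq_bigr => m' /andP[/supp[m'0 _] /eqP m'n].
    rewrite hornerZ hornerXn (bigD1 v1) //= big1 ?mulr1 // => i iv1.
    by have [->|ivn] := eqVneq i vn; rewrite ?m'n ?m'0 ?outer ?iv1.
  rewrite big_seq_cond [RHS]big_seq_cond; apply: eq_big => m'.
    by apply: andb_id2l => /supp[_]; case: (m' vn) => [|[|]].
  move=> /andP[/supp[m'0 _] /eqP m'n].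
  rewrite hornerZ hornerXn (bigD1 v1) //= (bigD1 vn) /= 1?eq_sym ?first_last_vertex // m'n expr1.
  rewrite big1 ?mulr1 ?mulrA // => i iv.
  by rewrite m'0 ?outer.
(* A monomial of [f] is determined by its exponents at [x_1] and [x_n], so no other term contributes
   to this coefficient. *)
have : (P (m vn))`_(m v1) = f@_m.
  rewrite coef_sum big_mkcond (bigD1_seq m) ?msupp_uniq //= eqxx.
  rewrite coefZ coefXn eqxx mulr1 big_seq_cond big1 ?addr0 // => m' /andP[m'f m'm].
  case: ifP => // /eqP m'n.
  rewrite coefZ coefXn; case: eqP => [m'1|]; last by rewrite mulr0.
  case/eqP: m'm; apply/mnmP => i.
  have [->|iv1] := eqVneq i v1; first by [].
  have [->|ivn] := eqVneq i vn; first by [].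
  have iM : i \in mids by rewrite outer // iv1.
  by have [m'0 _] := supp _ m'f; rewrite m0 // m'0.
have -> : P (m vn) = 0 by case: (m vn) mvn => [|[|]].
by rewrite coef0 => /esym/eqP; apply/negP; rewrite -mcoeff_msupp.
Qed.

(** Every leading monomial of the ideal is divisible by a middle variable or by [x_n^2], hence by a
    leading monomial of the basis. *)
Lemma hyperbola_groebner : groebner_basis (lex_vars n) I (conic_basis n_gt0 a b).
Proof.
have GP g : (g \in conic_basis n_gt0 a b) <-> (exists2 k, k \in mids & g = L k) \/ g = H.
  rewrite mem_rcons in_cons; split.
    by case/predU1P => [->|/mapP[k kM ->]]; [right | left; exists k].
  by case=> [[k kM ->]|->]; rewrite ?eqxx // map_f ?orbT.
have GI : {in conic_basis n_gt0 a b, forall g, I g}.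
  by move=> g /GP[[k _ ->]|->]; [exact: Lpoly_vanish | exact: Hpoly_vanish].
split=> //; apply/seteqP; split=> f [r [c [g [gS ->]]]].
  exists r, c, g; split=> // i; have [h [m [hG hm ->]]] := gS i.
  by exists h, m; split=> //; apply: GI.
have : forall i, exists dh : {mpoly C[n]} * {mpoly C[n]},
    leading_terms (lex_vars n) [set g | g \in conic_basis n_gt0 a b] dh.2 /\
    g i = dh.1 * dh.2.
  move=> i; have [h [m [Ih hm ->]]] := gS i.
  have [h' [m' [h'G h'm m'm]]] : exists h' m', [/\ h' \in conic_basis n_gt0 a b,
      is_leading_monomial (lex_vars n) h' m' & (m' <= m)%MM].
    have [[k kM mk]|mn] := leading_monomial_reducible Ih hm.
      exists (L k), U_(k)%MM; split; [by apply/GP; left; exists k | exact: Lpoly_leading |].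
      by apply/mnm_lepP => l; rewrite mnm1E; case: eqP => // <-.
    exists H, (U_(vn) + U_(vn))%MM; split; [by apply/GP; right | exact: Hpoly_leading |].
    by apply/mnm_lepP => l; rewrite mnmDE mnm1E; case: eqP => // <-.
  exists ((h@_m / h'@_m') *: 'X_[m - m'], h'@_m' *: 'X_[m']); split.
    by exists h', m'.
  have h'0 : h'@_m' != 0 by rewrite -mcoeff_msupp; case: h'm.
  by rewrite /= -scalerAl -scalerAr scalerA divfK // -mpolyXD submK.
move=> /choice[dh dhP]; exists r, (fun i => c i * (dh i).1), (fun i => (dh i).2).
split=> [i|]; first by case: (dhP i).
by apply: eq_bigr => i _; rewrite -mulrA; case: (dhP i) => _ <-.
Qed.

End ConicGroebner.

(** * Components *)

(** Composition runs from left to right: the first transposition sends [y] to the element that the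
    second maps to [k], and fixes [x], which the second maps to [j]. *)
Lemma exists_perm2 (T : finType) (x y j k : T) : x != y -> j != k ->
  exists s : {perm T}, s x = j /\ s y = k.
Proof.
move=> xy jk; exists (tperm y (tperm x j k) * tperm x j)%g.
rewrite !permM tpermL tpermK (tpermD (z := x)) ?tpermL //; first by rewrite eq_sym.
by rewrite -[x in _ != x](tpermR x j) (inj_eq perm_inj) eq_sym.
Qed.

Lemma hyperbola_relabel (C : numClosedFieldType) (n : nat) (s : {perm 'I_n})
    (a b : 'I_n -> C) :
  [set x \o s | x in hyperbola a b] = hyperbola (a \o s) (b \o s).
Proof.
apply/seteqP; split=> x; first by move=> [_ [t t0 ->] <-]; exists t.
by move=> [t t0 ->]; exists (fun i => (a i * t ^+ 2 + b i) / t) => //; exists t.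
Qed.

Theorem theorem5p5 (R : realType) (p q : nat) (hp : (0 < p)%N) (hq : (0 < q)%N)
    (Y : set ('I_(p + q) -> R[i])) :
  let hn : (0 < p + q)%N := ltn_addr q hp in
  irreducible_component (frieze_variety R[i] (Atilde p q)) Y ->
  [/\ isomorphic Y (affine_line R[i]) \/
        (exists2 Z : set ('I_2 -> R[i]), plane_conic Z & isomorphic Y Z),
      ~ isomorphic Y (affine_line R[i]) ->
        exists (s : {perm 'I_(p + q)}) (a b : 'I_(p + q) -> R[i]),
          let Y' := [set x \o s | x in Y] in
          [/\ forall i, a i != 0 /\ b i != 0,
              alpha hn a b != 0,
              Y' = zariski_closure (hyperbola a b) &
              groebner_basis (lex_vars (p + q)) (vanishing_ideal Y')
                (conic_basis hn a b)] &
      smooth Y].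
Proof.
move=> hn /(frieze_variety_component hp hq)[a [b [ab0 ->]]].
have n_gt1 : (1 < p + q)%N by rewrite -[2%N]/(1 + 1)%N leq_add.
have [[j [k D0]]|->] := hyperbola_cases hn ab0; last first.
  (* All minors vanish: [Y] is a line and the conic clause is vacuous. *)
  have [a0 _] := ab0 (Ordinal hn); have iso := origin_line_isomorphic a0.
  by split=> [|/(_ iso)|]; [left | | exact: smooth_origin_line a0].
have [ak0 bk0] := ab0 k; split=> [|_|]; last exact: smooth_nondegenerate_hyperbola D0.
  by right; exact: hyperbola_isomorphic_conic D0 ak0 bk0.
have jk : j != k by apply: contraNneq D0 => ->; rewrite subrr.
(* The relabelling moves the nonzero minor to the first and last vertices, where it becomes
   [alpha]. *)
have [s [s1 sn]] := exists_perm2 (first_last_vertex hn n_gt1) jk.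
have ab0s i : (a \o s) i != 0 /\ (b \o s) i != 0 by exact: ab0.
have alpha0 : alpha hn (a \o s) (b \o s) != 0 by rewrite /alpha /= s1 sn.
exists s, (a \o s), (b \o s) => /=; rewrite hyperbola_relabel; split=> //.
  by rewrite zariski_closure_id //; exact: zariski_closed_hyperbola.
exact: hyperbola_groebner.
Qed.
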